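(* Assume $\mu$ is atomless ($T=T_0$) and that (A$_1$), (A$_2$), (A$_3$), (A$_4'$) and (A$_5$) hold. Let $f$ be an exactly feasible allocation that is not in the NY-private core, and let $0<\epsilon<\mu(T)$. Then $f$ is NY-privately blocked by some coalition $S$ with $\mu(S)=\epsilon$.
   Context: Standing setup. $\Omega$ is a finite set of states with a $\sigma$-algebra $\mathcal F$. $(T,\Sigma,\mu)$ is a complete, finite, positive measure space of agents. $Y$ is an ordered Banach space whose positive cone $Y_+$ has nonempty interior; $x\gg0$ means $x\in\operatorname{int}Y_+$. Each agent $t$ has a partition $\Pi_t$ of $\Omega$ generating a $\sigma$-algebra $\mathcal F_t$, a utility $U_t:\Omega\times Y_+\to\mathbb R$, an initial endowment $a(t,\cdot):\Omega\to Y_+$ constant on elements of $\Pi_t$, and a prior $q_t$ with $q_t(\omega)>0$. $V_t(x)=\sum_\omega U_t(\omega,x(\omega))q_t(\omega)$. $a(\cdot,\omega)$ is Bochner integrable on $T$. A coalition is $S\in\Sigma$ with $\mu(S)>0$. An $S$-assignment is $f:S\times\Omega\to Y_+$ with $f(\cdot,\omega)$ Bochner integrable on $S$ for each $\omega$; an $S$-allocation is an $S$-assignment with $f(t,\cdot)$ $\mathcal F_t$-measurable for a.e. $t\in S$; it is $S$-exactly feasible if $\int_S f(\cdot,\omega)d\mu=\int_S a(\cdot,\omega)d\mu$ for all $\omega$. ($T$-allocations are allocations; $T$-exactly feasible is exactly feasible.) An allocation $f$ is NY-privately blocked by a coalition $S$ if there is an $S$-exactly feasible $S$-allocation $g$ with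 $V_t(g(t,\cdot))>V_t(f(t,\cdot))$ for a.e. $t\in S$. The NY-private core is the set of exactly feasible allocations not NY-privately blocked by any coalition. For a partition $\mathcal Q$, $T_{\mathcal Q}=\{t:\Pi_t=\mathcal Q\}$. (A$_1$): $t\mapsto q_t$ is measurable and $T_{\mathcal Q}\in\Sigma$ for all partitions $\mathcal Q$. (A$_2$): for each $\omega$, $t\mapsto U_t(\omega,x)$ is measurable and $U_t(\omega,\cdot)$ is norm-continuous. (A$_3$): for all $(t,\omega)$ and $x,y\in Y_+$ with $y\gg0$, $U_t(\omega,x+y)>U_t(\omega,x)$. (A$_4'$): $U_t(\omega,\cdot)$ is concave for all $(t,\omega)$. (A$_5$): $a(t,\omega)\gg0$ for all $(t,\omega)$. *)

(* Defs.v *)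
From HB Require Import structures.
From mathcomp Require Import all_boot all_order all_algebra.
From mathcomp Require Import all_classical all_reals all_analysis.
Set Implicit Arguments. Unset Strict Implicit. Unset Printing Implicit Defensive.
Import Order.TTheory GRing.Theory Num.Theory.
Import numFieldNormedType.Exports.
Local Open Scope classical_set_scope.
Local Open Scope ring_scope.

Section Defs.
Context {R : realType} {d : measure_display} {T : measurableType d}
  {Y : completeNormedModType R}.
Variable mu : {measure set T -> \bar R}.

Definition atomless : Prop :=
  forall A, measurable A -> (0 < mu A)%E ->
    exists B, [/\ measurable B, B `<=` A, (0 < mu B)%E & (mu B < mu A)%E].

Definition simple_ok (S : set T) (s : seq (set T * Y)) : Prop :=
  forall i, (i < size s)%N ->
    let p := nth (set0, 0) s i in
    [/\ measurable p.1, p.1 `<=` S & (mu p.1 < +oo)%E].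

Definition simple_eval (s : seq (set T * Y)) (t : T) : Y :=
  \sum_(p <- s) ((\1_(p.1) t : R) *: p.2).

Definition simple_int (s : seq (set T * Y)) : Y :=
  \sum_(p <- s) (fine (mu p.1) *: p.2).

Definition is_bochner_integral (S : set T) (f : T -> Y) (v : Y) : Prop :=
  exists s : nat -> seq (set T * Y),
    [/\ forall n, simple_ok S (s n),
        {ae mu, forall t, S t -> (fun n => simple_eval (s n) t) @ \oo --> f t},
        (fun n => (\int[mu]_(t in S) (`|f t - simple_eval (s n) t|)%:E)%E) @ \oo
          --> 0%E
      & (fun n => simple_int (s n)) @ \oo --> v].

Definition bochner_integrable (S : set T) (f : T -> Y) : Prop :=
  exists v, is_bochner_integral S f v.

End Defs.

Section Info.
Context {Omega : finType}.

(** sigma-algebra generated by a partition P: unions of blocks of P. *)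
Definition gen_sigma (P : {set {set Omega}}) : set (set Omega) :=
  [set A | forall B, B \in P -> (forall w, w \in B -> A w) \/
                                (forall w, w \in B -> ~ A w)].

(** Measurability of x : Omega -> Y w.r.t. sigma(P) (Borel sigma-algebra on
    Y, generated by open sets). *)
Definition P_measurable {Y : topologicalType} (P : {set {set Omega}})
  (x : Omega -> Y) : Prop :=
  forall O : set Y, open O -> gen_sigma P (x @^-1` O).

Definition sigma_alg_fin (F : set (set Omega)) : Prop :=
  [/\ F setT, forall A, F A -> F (~` A) & forall A B, F A -> F B -> F (A `|` B)].

End Info.

(* Main.v *)
(* Vind's argument, with exact feasibility and partition-measurability.

   Let g block f via A and let e be interior to the cone.  On a large part D
   of A, mixing g with the bundle b (the endowment, less r e on a subset E of A
   of positive measure) keeps the agents strictly better off, by concavity, and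
   frees a positive multiple of e in every state.  Mixing the result with f at
   rate al on A, and keeping f outside A, gives k.  Choose S so that it contains
   the fraction lam of A and the fraction lam (1 - al) of its complement,
   uniformly over all information types Q, and so that the integrals of k over
   S and over each S /\ T_Q almost follow these fractions.  The rates are
   chosen so that mu S = eps and so that exact feasibility of f on T and of g
   on A cancel everything in the total except the gain in e and small errors.

   Since redistribution must respect information, the gain is handed back as
   tau e, constant in the state, to every agent, and the error of type Q, which
   is constant on the blocks of Q, is charged to the agents of type Q only.  As
   e is interior, each agent's net transfer is interior to the cone, so A3
   makes everyone in S strictly better off. *)
Require Import Defs.
From HB Require Import structures.
From mathcomp Require Import all_boot all_order all_algebra.
From mathcomp Require Import all_classical all_reals all_analysis.
From mathcomp Require Import measurable_realfun.
From mathcomp Require Import ring lra.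
Import Order.TTheory GRing.Theory Num.Theory.
Import numFieldNormedType.Exports.
Set Implicit Arguments.
Unset Strict Implicit.
Unset Printing Implicit Defensive.
Local Open Scope classical_set_scope.
Local Open Scope ring_scope.

(** * Atomless measures *)

Section FiniteMeasure.
Context {R : realType} {d : measure_display} {T : measurableType d}.
Variable mu : {measure set T -> \bar R}.
Hypothesis mu_fin : (mu setT < +oo)%E.

(** Since [mu] is finite, [fine] loses nothing on measurable sets, and measures become reals open to
    [lra]. *)
Definition rmeas (A : set T) : R := fine (mu A).
Local Notation m := rmeas.

Lemma rmeasE A : measurable A -> mu A = (m A)%:E.
Proof.
move=> mA; rewrite /m fineK// ge0_fin_numE//.
by apply: le_lt_trans mu_fin; apply: le_measure => //; rewrite inE.
Qed.

Lemma rmeas_ge0 A : 0 <= m A. Proof. exact: fine_ge0. Qed.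

Lemma rmeas0 : m set0 = 0. Proof. by rewrite /m measure0. Qed.

Lemma le_rmeas A B : measurable A -> measurable B -> A `<=` B -> m A <= m B.
Proof.
move=> mA mB AB; rewrite -lee_fin -!rmeasE//.
by apply: le_measure => //; rewrite inE.
Qed.

Lemma rmeasU A B : measurable A -> measurable B -> A `&` B = set0 ->
  m (A `|` B) = m A + m B.
Proof.
move=> mA mB AB0; apply/EFin_inj.
rewrite EFinD -!rmeasE//; last exact: measurableU.
by rewrite measureU.
Qed.

Lemma rmeasID P A : measurable P -> measurable A ->
  m A = m (A `&` P) + m (A `\` P).
Proof.
move=> mP mA; rewrite -rmeasU.
- by rewrite -setIUr setUv setIT.
- exact: measurableI.
- exact: measurableD.
- by rewrite setDE setIACA setIid setICr setI0.
Qed.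

Lemma rmeasD A B : measurable A -> measurable B -> B `<=` A ->
  m (A `\` B) = m A - m B.
Proof.
by move=> mA mB BA; rewrite (rmeasID mB mA) (setIidr BA); lra.
Qed.

Lemma rmeas_bigcup (u : nat -> set T) : (forall n, measurable (u n)) ->
  (forall n, u n `<=` u n.+1) -> (fun n => m (u n)) @ \oo --> m (\bigcup_n u n).
Proof.
move=> mu_ u_; have mU : measurable (\bigcup_n u n) by exact: bigcupT_measurable.
suff : (mu \o u) @ \oo --> (m (\bigcup_n u n))%:E by move/fine_cvg.
rewrite -rmeasE//; apply: nondecreasing_cvg_mu => //.
by apply/nondecreasing_seqP => n; apply/subsetPset.
Qed.

Section Atomless.
Hypothesis mu_atomless : atomless mu.

(** Atomlessness splits [A] into two pieces of positive measure, and the smaller one has at most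
    half of the total. *)
Lemma atomless_half A : measurable A -> 0 < m A ->
  exists B, [/\ measurable B, B `<=` A, 0 < m B & m B <= m A / 2].
Proof.
move=> mA A0.
have [|B [mB BA]] := mu_atomless mA; first by rewrite (rmeasE mA) lte_fin.
rewrite !rmeasE// !lte_fin => B0 BltA.
case: (lerP (m B) (m A / 2)) => h; first by exists B.
exists (A `\` B); split; [exact: measurableD| exact: subDsetl| |];
  rewrite rmeasD//; lra.
Qed.

(** Iterate the halving [n] times, where [m A / c <= n <= 2 ^ n]. *)
Lemma atomless_small A (c : R) : measurable A -> 0 < m A -> 0 < c ->
  exists B, [/\ measurable B, B `<=` A, 0 < m B & m B <= c].
Proof.
move=> mA A0 c0.
suff H n : exists B, [/\ measurable B, B `<=` A, 0 < m B & m B <= m A / 2 ^+ n].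
  have [n hn] : exists n : nat, m A / c <= n%:R.
    by exists (Num.truncn (m A / c)).+1; apply/ltW; exact: truncnS_gt.
  have [B [mB BA B0 hB]] := H n; exists B; split => //.
  apply: le_trans hB _; rewrite ler_pdivrMr ?exprn_gt0//.
  rewrite -ler_pdivrMl// mulrC; apply: le_trans hn _.
  by rewrite -natrX ler_nat ltnW// ltn_expl.
elim: n => [|n [B [mB BA B0 hB]]]; first by exists A; split => //; rewrite expr0 divr1.
have [C [mC CB C0 hC]] := atomless_half mB B0.
exists C; split => //; first exact: subset_trans CB BA.
by apply: le_trans hC _; rewrite exprSr invfM mulrA ler_pM2r// invr_gt0.
Qed.

(** Greedy exhaustion: starting from the empty set, each step enlarges the current set within the
    budget [c] and realises at least half of the largest possible gain. If the union [B] of the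
    steps still had measure below [c], a small [D] outside [B] could be added at every stage, so
    [m D] would be at most twice the remaining gain [m B - m (u n)], which tends to 0. *)
Lemma atomless_sub A (c : R) : measurable A -> 0 <= c -> c <= m A ->
  exists B, [/\ measurable B, B `<=` A & m B = c].
Proof.
move=> mA c0 cA.
pose P B := [/\ measurable B, B `<=` A & m B <= c].
have /choice[F HF] : forall B, exists C, P B -> [/\ P C, B `<=` C &
    forall B', P B' -> B `<=` B' -> m B' - m B <= 2 * (m C - m B)].
  move=> B.
  case: (pselect (P B)) => PB; last by exists B => /PB.
  pose X := [set m B' | B' in [set B' | P B' /\ B `<=` B']].
  have XB : X (m B) by exists B; first (split; [exact: PB | exact: subset_refl]).
  have ubX : ubound X c by move=> _ [B' [[]]] + + + + <-.
  have supX : has_sup X by split; [exists (m B) | exists c].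
  have sB : m B <= sup X by apply: ub_le_sup => //; exists c.
  have [sBe|sBlt] := eqVneq (sup X) (m B).
    exists B => _; split => // B' PB' BB'.
    have : m B' <= sup X by apply: ub_le_sup; [exists c | exists B'].
    lra.
  have [|_ [C [PC BC] <-] hC] := @sup_adherent _ X ((sup X - m B) / 2) _ supX.
    by rewrite divr_gt0// subr_gt0 lt_neqAle eq_sym sBlt.
  exists C => _; split => // B' PB' BB'.
  have : m B' <= sup X by apply: ub_le_sup; [exists c | exists B'].
  lra.
pose u n := iter n F set0.
have Pu n : P (u n).
  elim: n => [|n IH]; first by split; [exact: measurable0|exact: sub0set|rewrite /u /= rmeas0].
  by have [] := HF _ IH.
have uS n : u n `<=` u n.+1 by have [] := HF _ (Pu n).
have mu_ n : measurable (u n) by have [] := Pu n.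
set B := \bigcup_n u n.
have mB : measurable B by exact: bigcupT_measurable.
have BA : B `<=` A by move=> t [n _]; have [_ + _] := Pu n; exact.
have cvB := rmeas_bigcup mu_ uS.
have Bc : m B <= c.
  by apply: (cvgr_to_le cvB); near=> n; have [] := Pu n.
exists B; split => //; apply/eqP; rewrite eq_le Bc /= leNgt; apply/negP => Bltc.
have [|||D [mD DAB D0 Dc]] := @atomless_small (A `\` B) (c - m B).
- exact: measurableD.
- by rewrite rmeasD//; lra.
- by lra.
have BD0 : B `&` D = set0.
  by apply/seteqP; split => // t [Bt /DAB []].
have mBD : m (B `|` D) = m B + m D by rewrite rmeasU.
have H n : m D <= 2 * (m B - m (u n)).
  have [[m1 m2 m3] _ /(_ (B `|` D))] := HF _ (Pu n).
  have uB k : m (u k) <= m B by apply: le_rmeas => //; exact: bigcup_sup.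
  have PBD : P (B `|` D).
    split; [exact: measurableU| |rewrite mBD; lra].
    by move=> t [/BA//|/DAB []].
  have uBD : u n `<=` B `|` D.
    by apply: subset_trans (@subsetUl _ _ _); exact: bigcup_sup.
  by move=> /(_ PBD uBD); rewrite mBD; have := uB n; have := uB n.+1; rewrite /=; lra.
suff : m D <= 0 by lra.
have -> : 0 = 2 * (m B - m B) :> R by lra.
have cv : (fun n => 2 * (m B - m (u n))) @ \oo --> 2 * (m B - m B).
  by apply: cvgMl_tmp; apply: cvgB cvB; exact: cvg_cst.
by apply: (cvgr_to_ge cv); near=> n.
Unshelve. all: by end_near. Qed.

(** Induction on [l]: the head set cuts [A] in two, each half is treated for the tail, and the two
    selections are united. At the leaves only the total measure is prescribed. *)
Lemma atomless_proportional (l : seq (set T)) A (lam : R) :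
  {in l, forall P, measurable P} ->
  measurable A -> 0 <= lam <= 1 ->
  exists B, [/\ measurable B, B `<=` A, m B = lam * m A &
    {in l, forall P, m (B `&` P) = lam * m (A `&` P)}].
Proof.
move=> + + /andP[l0 l1]; elim: l A => [|P l IH] A ml mA.
  have [|||B [mB BA Bm]] := @atomless_sub A (lam * m A) => //.
  - by rewrite mulr_ge0// rmeas_ge0.
  - by rewrite ler_piMl// rmeas_ge0.
  by exists B.
have mP : measurable P by apply: ml; rewrite inE eqxx.
have ml' : {in l, forall P, measurable P}.
  by move=> Q Ql; apply: ml; rewrite inE Ql orbT.
have mAP : measurable (A `&` P) by exact: measurableI.
have mAD : measurable (A `\` P) by exact: measurableD.
have [B1 [mB1 B1A e1 i1]] := IH _ ml' mAP.
have [B2 [mB2 B2A e2 i2]] := IH _ ml' mAD.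
have B120 : B1 `&` B2 = set0.
  by apply/seteqP; split => // t [/B1A [_ +] /B2A [_ +]].
exists (B1 `|` B2); split.
- exact: measurableU.
- by move=> t [/B1A []|/B2A []].
- by rewrite rmeasU// e1 e2 (rmeasID mP mA); lra.
move=> Q; rewrite inE => /orP[/eqP ->|Ql].
  rewrite -e1; congr m; apply/seteqP; split => t.
    by move=> [[//|/B2A [_ +]]].
  by move=> Bt; split; [left|have [] := B1A _ Bt].
have mQ := ml' _ Ql.
rewrite setIUl rmeasU; [|exact: measurableI|exact: measurableI|]; last first.
  by rewrite setIACA B120 set0I.
rewrite i1// i2// (@rmeasID P (A `&` Q))//; last exact: measurableI.
by rewrite -mulrDr (setIAC A Q P) (setIDAC A P Q) setIDA.
Qed.

End Atomless.
End FiniteMeasure.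

(** * Simple and strongly measurable functions *)

Section SimpleFunctions.
Context {R : realType} {d : measure_display} {T : measurableType d}
  {Y : completeNormedModType R}.
Variable mu : {measure set T -> \bar R}.
Hypothesis mu_fin : (mu setT < +oo)%E.
Hypothesis mu_complete : measure_is_complete mu.
Local Notation m := (rmeas mu).
Local Notation simple := (seq (set T * Y)).
Implicit Types (s : simple) (f g : T -> Y).

Definition msimple s := forall p, p \in s -> measurable p.1.

Lemma simple_okP (S : set T) s :
  simple_ok mu S s <-> (forall p, p \in s -> measurable p.1 /\ p.1 `<=` S).
Proof.
split=> [ok p /(nthP (set0, 0))[i ilt <-]|ok i ilt p].
  by have [] := ok i ilt.
have /ok[mp pS] : p \in s by exact: mem_nth.
split => //; rewrite (rmeasE mu_fin mp) ltry//.
Qed.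

Lemma simple_ok_setT s : simple_ok mu setT s <-> msimple s.
Proof.
rewrite simple_okP; split => ok p ps; first by have [] := ok p ps.
by split => //; exact: ok.
Qed.

Lemma msimple_cons p s : msimple (p :: s) <-> measurable p.1 /\ msimple s.
Proof.
split=> [h|[hp hs] q]; last by rewrite inE => /orP[/eqP ->//|/hs].
by split=> [|q qs]; apply: h; rewrite inE ?eqxx// qs orbT.
Qed.

Lemma msimple_cat s s' : msimple s -> msimple s' -> msimple (s ++ s').
Proof. by move=> h h' p; rewrite mem_cat => /orP[/h|/h']. Qed.

Definition simple_scale (c : R) s : simple := [seq (p.1, c *: p.2) | p <- s].

Definition simple_restrict (C : set T) s : simple :=
  [seq (p.1 `&` C, p.2) | p <- s].

Lemma msimple_scale c s : msimple s -> msimple (simple_scale c s).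
Proof. by move=> h p /mapP[q /h mq ->]. Qed.

Lemma msimple_restrict C s : measurable C -> msimple s ->
  msimple (simple_restrict C s).
Proof. by move=> mC h p /mapP[q /h mq ->]; exact: measurableI. Qed.

Lemma simple_eval_cat s s' t :
  simple_eval (s ++ s') t = simple_eval s t + simple_eval s' t :> Y.
Proof. by rewrite /simple_eval big_cat. Qed.

Lemma simple_eval_scale c s t :
  simple_eval (simple_scale c s) t = c *: simple_eval s t :> Y.
Proof.
rewrite /simple_eval big_map scaler_sumr; apply: eq_bigr => p _ /=.
by rewrite !scalerA mulrC.
Qed.

Lemma simple_eval_restrict C s t :
  simple_eval (simple_restrict C s) t = (\1_C t : R) *: simple_eval s t :> Y.
Proof.
rewrite /simple_eval big_map scaler_sumr; apply: eq_bigr => p _ /=.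
by rewrite scalerA indicI mulrC.
Qed.

Lemma simple_int_cat s s' :
  simple_int mu (s ++ s') = simple_int mu s + simple_int mu s' :> Y.
Proof. by rewrite /simple_int big_cat. Qed.

Lemma simple_int_scale c s :
  simple_int mu (simple_scale c s) = c *: simple_int mu s :> Y.
Proof.
rewrite /simple_int big_map scaler_sumr; apply: eq_bigr => p _ /=.
by rewrite !scalerA mulrC.
Qed.

(** A simple function is constant on each of finitely many measurable pieces, so [F] is only ever
    read at fixed vectors. This allows composing with a possibly discontinuous choice of nearest
    points. *)
Lemma measurable_simple_comp (F : T -> Y -> R) s :
  (forall x, measurable_fun setT (F ^~ x)) -> msimple s ->
  measurable_fun setT (fun t => F t (simple_eval s t)).
Proof.
move=> mF ms.
(* Generalized over an offset x and a domain C: splitting C along the first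
   set of s moves its vector into the offset. *)
suff H x C : measurable C -> measurable_fun C (fun t => F t (x + simple_eval s t)).
  have := H 0 setT measurableT; congr (measurable_fun _ _).
  by apply/funext => t; rewrite add0r.
elim: s ms x C => [|p s IH] ms x C mC.
  apply: (eq_measurable_fun (F ^~ x)).
    by move=> t _; rewrite /simple_eval big_nil addr0.
  by apply: measurable_funS (mF x).
have /msimple_cons[mp /IH{}IH] := ms.
rewrite -(setUIDK C p.1); apply/measurable_funU; [exact: measurableI|exact: measurableD|split].
- apply: (eq_measurable_fun (fun t => F t ((x + p.2) + simple_eval s t))).
    move=> t; rewrite inE => -[_ pt].
    by rewrite /simple_eval big_cons indicE mem_set// scale1r addrA.
  by apply: IH; exact: measurableI.
- apply: (eq_measurable_fun (fun t => F t (x + simple_eval s t))).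
    move=> t; rewrite inE => -[_ pt].
    by rewrite /simple_eval big_cons indicE memNset// scale0r add0r.
  by apply: IH; exact: measurableD.
Qed.

(** The sets of [s] may overlap and their vectors may cancel, so a term-by-term triangle inequality
    is too weak. The induction again carries an offset and a domain, and splits the domain along the
    first set; the triangle inequality is applied across the two disjoint parts. *)
Lemma norm_simple_int s : msimple s ->
  ((`|simple_int mu s|)%:E <= \int[mu]_t (`|simple_eval s t|)%:E)%E.
Proof.
move=> ms.
suff H x C : measurable C ->
    ((`|m C *: x + \sum_(p <- s) m (p.1 `&` C) *: p.2|)%:E <=
     \int[mu]_(t in C) (`|x + simple_eval s t|)%:E)%E.
  have := H 0 setT measurableT; rewrite scaler0 add0r.
  under eq_bigr do rewrite setIT.
  by under eq_integral do rewrite add0r.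
elim: s ms x C => [|p s IH] ms x C mC.
  rewrite big_nil addr0.
  under eq_integral do rewrite /simple_eval big_nil addr0.
  rewrite integral_cst// (rmeasE mu_fin mC) -EFinM lee_fin normrZ.
  by rewrite ger0_norm ?rmeas_ge0// mulrC.
have /msimple_cons[mp ms'] := ms; move/(_ ms') in IH.
have mCp : measurable (C `&` p.1) by exact: measurableI.
have mCD : measurable (C `\` p.1) by exact: measurableD.
rewrite -{3}(setUIDK C p.1) ge0_integral_setU//; last 2 first.
  - apply/measurable_EFinP.
    apply: (@measurable_funS _ _ _ _ setT) => //.
    by apply: (@measurable_simple_comp (fun _ y => `|x + y|)).
  - by apply/disj_setPS => t [[_ pt] [_]]; exact.
have -> : (\int[mu]_(t in C `&` p.1) (`|x + simple_eval (p :: s) t|)%:E =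
    \int[mu]_(t in C `&` p.1) (`|(x + p.2) + simple_eval s t|)%:E)%E.
  apply: eq_integral => t; rewrite inE => -[_ pt].
  by rewrite /simple_eval big_cons indicE mem_set// scale1r addrA.
have -> : (\int[mu]_(t in C `\` p.1) (`|x + simple_eval (p :: s) t|)%:E =
    \int[mu]_(t in C `\` p.1) (`|x + simple_eval s t|)%:E)%E.
  apply: eq_integral => t; rewrite inE => -[_ pt].
  by rewrite /simple_eval big_cons indicE memNset// scale0r add0r.
apply: le_trans (leeD (IH (x + p.2) _ mCp) (IH x _ mCD)).
rewrite -EFinD lee_fin; apply: le_trans (ler_normD _ _).
rewrite le_eqVlt; apply/orP; left; apply/eqP; congr (`|_|).
rewrite big_cons (rmeasID mu_fin mp mC) scalerDl scalerDr (setIC p.1).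
have -> : \sum_(j <- s) m (j.1 `&` C) *: j.2 =
    \sum_(j <- s) m (j.1 `&` (C `&` p.1)) *: j.2 +
    \sum_(j <- s) m (j.1 `&` (C `\` p.1)) *: j.2.
  rewrite -big_split/=; apply: eq_big_seq => q qs.
  have mq := ms' _ qs.
  rewrite -scalerDl (@rmeasID _ _ _ mu mu_fin p.1 (q.1 `&` C)) ?setIA ?setIDA//.
  exact: measurableI.
by rewrite [LHS]addrACA addrA [RHS]addrACA.
Qed.

Definition strongly_measurable f := exists s : nat -> simple,
  (forall n, msimple (s n)) /\
  {ae mu, forall t, (fun n => simple_eval (s n) t) @ \oo --> f t}.

Lemma strongly_measurableD f g : strongly_measurable f ->
  strongly_measurable g -> strongly_measurable (f \+ g).
Proof.
move=> [s [ms sf]] [s' [ms' sg]]; exists (fun n => s n ++ s' n); split.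
  by move=> n; exact: msimple_cat.
apply: filterS2 sf sg => t ft gt.
under eq_fun do rewrite simple_eval_cat; exact: cvgD.
Qed.

Lemma strongly_measurableZ (c : R) f : strongly_measurable f ->
  strongly_measurable (fun t => c *: f t).
Proof.
move=> [s [ms sf]]; exists (fun n => simple_scale c (s n)); split.
  by move=> n; exact: msimple_scale.
apply: filterS sf => t ft.
under eq_fun do rewrite simple_eval_scale; exact: cvgZl_tmp.
Qed.

Lemma strongly_measurable_simple s : msimple s ->
  strongly_measurable (simple_eval s).
Proof.
by move=> ms; exists (fun=> s); split => //; apply: aeW => t; exact: cvg_cst.
Qed.

(** Off a null set the limit is pointwise; on the null set completeness makes every function
    measurable. *)
Lemma ae_cvg_measurable (h : nat -> T -> R) (k : T -> R) :
  (forall n, measurable_fun setT (h n)) ->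
  {ae mu, forall t, h n t @[n --> \oo] --> k t} -> measurable_fun setT k.
Proof.
move=> mh [N [mN N0 kN]].
have -> : setT = N `|` ~` N by rewrite setUv.
apply/measurable_funU; [by []|exact: measurableC|split].
  move=> _ B mB; apply: mu_complete; exists N; split => //; exact: subIsetl.
apply: (@measurable_fun_cvg _ _ _ _ h).
  by move=> n; apply: measurable_funS (mh n).
by move=> t Nt; apply: contrapT => ht; apply: Nt; exact: kN.
Qed.

(** The distance to [K] need not be attained, whence the slack, which vanishes as [n] grows. *)
Lemma nearest_point (K : set Y) (n : nat) (x : Y) : K !=set0 ->
  exists y, K y /\ forall z, K z -> `|x - y| <= `|x - z| + n.+1%:R^-1.
Proof.
move=> [k0 Kk0]; pose X := [set `|x - z| | z in K].
have hX : has_inf X.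
  by split; [exists `|x - k0|; exists k0|exists 0 => _ [z _ <-]].
have n0 : 0 < n.+1%:R^-1 :> R by [].
have [_ [y Ky <-] hy] := inf_adherent n0 hX.
exists y; split => // z Kz.
apply/ltW/(lt_le_trans hy); rewrite lerD2r.
by apply: ge_inf; [case: hX|exists z].
Qed.

(* The simple approximants of f may leave K, hence the nearest points. *)
Lemma measurable_caratheodory (K : set Y) (F : T -> Y -> R) f :
  (forall t, K (f t)) -> strongly_measurable f ->
  (forall x, K x -> measurable_fun setT (F ^~ x)) ->
  (forall t, {within K, continuous (F t)}) ->
  measurable_fun setT (fun t => F t (f t)).
Proof.
move=> Kf [s [ms sf]] mF cF.
(* When [T] is empty, [K] may be empty too and offers no nearest point; the claim is then
   trivial. *)
have [[t0 _]|T0] := pselect (exists t : T, True); last first.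
  by move=> _ B _; rewrite (_ : _ `&` _ = set0)//; apply/seteqP; split => // t _; apply: T0; exists t.
have K0 : K !=set0 by exists (f t0).
have /choice[phi Hphi] : forall nx : nat * Y, exists y, K y /\
    forall z, K z -> `|nx.2 - y| <= `|nx.2 - z| + nx.1.+1%:R^-1.
  by move=> nx; exact: nearest_point.
apply: (@ae_cvg_measurable (fun n t => F t (phi (n, simple_eval (s n) t)))).
  move=> n; apply: (@measurable_simple_comp (fun t x => F t (phi (n, x)))) => // x.
  by apply: mF; have [] := Hphi (n, x).
apply: filterS sf => t ft.
have Kphi n : K (phi (n, simple_eval (s n) t)) by have [] := Hphi (n, simple_eval (s n) t).
(* As [f t] lies in [K], it competes with the chosen point, which is therefore within twice the
   approximation error plus the slack of [f t]: three thirds of [e]. *)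
have cphi : (fun n => phi (n, simple_eval (s n) t)) @ \oo --> f t.
  apply/cvgrPdist_le => e e0.
  have h1 : \forall n \near \oo, `|f t - simple_eval (s n) t| < e / 3.
    by apply: cvgr_dist_lt; rewrite // divr_gt0.
  have h2 : \forall n \near \oo, n.+1%:R^-1 < e / 3.
    by apply: near_infty_natSinv_lt (PosNum (divr_gt0 e0 _)).
  near=> n.
  have a1 : `|f t - simple_eval (s n) t| < e / 3 by near: n.
  have a2 : n.+1%:R^-1 < e / 3 by near: n.
  have [_ /(_ _ (Kf t))] := Hphi (n, simple_eval (s n) t); rewrite /= => a3.
  have := ler_distD (simple_eval (s n) t) (f t) (phi (n, simple_eval (s n) t)).
  rewrite (distrC (simple_eval (s n) t) (f t)) in a3.
  move: a1 a2 a3; move: (n.+1%:R^-1) => z; lra.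
have /subspace_continuousP/(_ _ (Kf t)) := cF t.
apply: cvg_comp; move=> A; rewrite /within/= => hA.
have : \forall n \near \oo, K (phi (n, simple_eval (s n) t)) ->
  A (phi (n, simple_eval (s n) t)) by exact: (cphi _ hA).
by apply: filterS => n; apply; exact: Kphi.
Unshelve. all: by end_near. Qed.

Lemma measurable_norm f : strongly_measurable f ->
  measurable_fun setT (fun t => `|f t|).
Proof.
move=> mf; apply: (@measurable_caratheodory setT (fun _ x => `|x|)) => //.
by move=> _; apply: continuous_subspaceT => x; exact: norm_continuous.
Qed.

(** [O] is the set where the distance [D] to its complement is positive, and [D] is 1-Lipschitz, so
    [D \o f] is measurable. The case of an empty complement, where the infimum would be meaningless,
    is set apart. *)
Lemma measurable_preimage_open f (O : set Y) : strongly_measurable f ->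
  open O -> measurable (f @^-1` O).
Proof.
move=> mf oO.
have [[x0 Ox0]|] := pselect (exists x, ~ O x); last first.
  move=> nO; rewrite (_ : _ @^-1` _ = setT)//; apply/seteqP; split => // t _.
  by apply: contrapT => h; apply: nO; exists (f t).
pose D (x : Y) := inf [set `|x - z| | z in ~` O].
have infD x : has_inf [set `|x - z| | z in ~` O].
  by split; [exists `|x - x0|; exists x0|exists 0 => _ [z _ <-]].
have DL x y : D x <= `|x - y| + D y.
  rewrite -lerBlDl; apply: lb_le_inf; first by have [] := infD y.
  move=> _ [z nOz <-]; rewrite lerBlDl.
  apply: le_trans (ler_distD y x z); apply: ge_inf; first by have [] := infD x.
  by exists z.
have cD : continuous D.
  move=> x; apply/cvgrPdist_le => e e0; near=> y.
  have h : `|x - y| <= e by near: y; apply: cvgr_dist_le.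
  rewrite ler_norml; have := DL x y; have := DL y x; rewrite (distrC y x).
  by move=> h1 h2; apply/andP; split; lra.
have OD x : O x <-> 0 < D x.
  split=> [Ox|].
    have /nbhs_normP[e e0 eO] : nbhs x O by move: oO; rewrite openE; exact.
    apply: (lt_le_trans e0); apply: lb_le_inf; first by have [] := infD x.
    move=> _ [z nOz <-]; rewrite leNgt; apply/negP => h; exact/nOz/eO.
  move=> D0; apply: contrapT => nO.
  suff : D x <= 0 by lra.
  apply: ge_inf; first by have [] := infD x.
  by exists x => //; rewrite subrr normr0.
rewrite (_ : _ @^-1` _ = setT `&` (D \o f) @^-1` `]0, +oo[%classic).
  have : measurable_fun setT (D \o f).
    apply: (@measurable_caratheodory setT (fun _ => D)) => //.
    by move=> _; apply: continuous_subspaceT.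
  by apply; [exact: measurableT|exact: measurable_itv].
rewrite setTI; apply/seteqP; split => t /=; rewrite in_itv/= andbT; by move/OD.
Unshelve. all: by end_near. Qed.

End SimpleFunctions.

(** * The Bochner integral *)

Lemma cvge0_near_lt (R : realType) (u : nat -> \bar R) (e : R) :
  u @ \oo --> 0%E -> 0 < e -> \forall n \near \oo, (u n < e%:E)%E.
Proof.
move=> u0 e0; apply: (u0 (fun x => x < e%:E)%E).
by apply: open_ereal_lt'; rewrite lte_fin.
Qed.

Section BochnerIntegral.
Context {R : realType} {d : measure_display} {T : measurableType d}
  {Y : completeNormedModType R}.
Variable mu : {measure set T -> \bar R}.
Hypothesis mu_fin : (mu setT < +oo)%E.
Hypothesis mu_complete : measure_is_complete mu.
Local Notation m := (rmeas mu).
Local Notation simple := (seq (set T * Y)).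
Local Notation L1 f := (\int[mu]_t (`|f t|)%:E)%E.
Local Notation bochner f v := (is_bochner_integral mu setT f v).
Implicit Types (s : simple) (f g : T -> Y).

Lemma bochner_strongly_measurable f v : bochner f v -> strongly_measurable mu f.
Proof.
move=> [s [ok sf _ _]]; exists s; split; first by move=> n; apply/(simple_ok_setT mu_fin).
by apply: filterS sf => t; exact.
Qed.

Lemma measurable_normE f : strongly_measurable mu f ->
  measurable_fun setT (fun t => (`|f t|)%:E).
Proof. by move=> mf; apply/measurable_EFinP; exact: (measurable_norm mu_complete mf). Qed.

Lemma L1_ge0 f : (0 <= L1 f)%E.
Proof. by apply: integral_ge0 => t _; rewrite lee_fin. Qed.

Lemma le_L1D f g : strongly_measurable mu f -> strongly_measurable mu g ->
  (L1 (f \+ g) <= L1 f + L1 g)%E.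
Proof.
move=> mf mg; rewrite -ge0_integralD//; try exact: measurable_normE.
apply: ge0_le_integral => //.
- exact/measurable_normE/strongly_measurableD.
- by apply: emeasurable_funD; exact: measurable_normE.
- by move=> t _; rewrite -EFinD lee_fin ler_normD.
Qed.

Lemma le_L1 f g : strongly_measurable mu f -> strongly_measurable mu g ->
  (forall t, `|f t| <= `|g t|) -> (L1 f <= L1 g)%E.
Proof.
move=> mf mg h; apply: ge0_le_integral => //; try exact: measurable_normE.
by move=> t _; rewrite lee_fin.
Qed.

Lemma strongly_measurableB f g : strongly_measurable mu f ->
  strongly_measurable mu g -> strongly_measurable mu (fun t => f t - g t).
Proof.
move=> mf mg; have := strongly_measurableD mf (strongly_measurableZ (-1) mg).
by congr strongly_measurable; apply/funext => t /=; rewrite scaleN1r.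
Qed.

Lemma strongly_measurable_indic (C : set T) f : measurable C ->
  strongly_measurable mu f ->
  strongly_measurable mu (fun t => (\1_C t : R) *: f t).
Proof.
move=> mC [s [ms sf]]; exists (fun n => simple_restrict C (s n)); split.
  by move=> n; exact: msimple_restrict.
apply: filterS sf => t ft.
under eq_fun do rewrite simple_eval_restrict; exact: cvgZl_tmp.
Qed.

Lemma L1_simple_fin s : msimple s -> (L1 (simple_eval s) < +oo)%E.
Proof.
elim: s => [_|p s IH /msimple_cons[mp ms]].
  under eq_integral do rewrite /simple_eval big_nil normr0.
  by rewrite integral0 ltry.
have ms1 : msimple [:: p] by apply/msimple_cons; split.
have -> : simple_eval (p :: s) = simple_eval [:: p] \+ simple_eval s :> (T -> Y).
  by apply/funext => t; rewrite /= -simple_eval_cat.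
apply: le_lt_trans (le_L1D _ _) _; try exact: strongly_measurable_simple.
rewrite lte_add_pinfty ?IH//.
apply: (@le_lt_trans _ _ (\int[mu]_t (cst (`|p.2|)%:E t))%E); last first.
  by rewrite integral_cst// (rmeasE mu_fin measurableT) -EFinM ltry.
apply: ge0_le_integral => //.
  exact/measurable_normE/strongly_measurable_simple.
move=> t _; rewrite lee_fin /simple_eval big_seq1 normrZ ler_piMl//.
by rewrite indicE; case: (_ \in _); rewrite ?normr1 ?normr0.
Qed.

Lemma bochner_approx f v (e : R) : bochner f v -> 0 < e ->
  exists s, [/\ msimple s, (L1 (fun t => f t - simple_eval s t) < e%:E)%E &
    `|simple_int mu s - v| < e].
Proof.
move=> [s [ok _ sf sv]] e0.
have h1 : \forall n \near \oo, (L1 (fun t => f t - simple_eval (s n) t) < e%:E)%E.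
  exact: cvge0_near_lt.
have h2 : \forall n \near \oo, `|v - simple_int mu (s n)| < e by exact: cvgr_dist_lt.
have [n [h1n h2n]] : exists n, (L1 (fun t => f t - simple_eval (s n) t) < e%:E)%E
   /\ `|v - simple_int mu (s n)| < e.
  by near \oo => n; exists n; split; near: n.
exists (s n); split => //; last by rewrite distrC.
exact/(simple_ok_setT mu_fin).
Unshelve. all: by end_near. Qed.

Lemma L1_fin f v : bochner f v -> (L1 f < +oo)%E.
Proof.
move=> Bf; have mf := bochner_strongly_measurable Bf.
have [s [ms sf _]] := bochner_approx Bf ltr01.
have mse := strongly_measurable_simple mu ms.
have := le_L1D (strongly_measurableB mf mse) mse.
have -> : (fun t => f t - simple_eval s t) \+ simple_eval s = f.
  by apply/funext => t /=; rewrite subrK.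
move=> /le_lt_trans; apply; rewrite lte_add_pinfty ?L1_simple_fin//.
exact: lt_trans sf (ltry _).
Qed.

Lemma le_norm_bochner f v : bochner f v -> ((`|v|)%:E <= L1 f)%E.
Proof.
move=> Bf; have mf := bochner_strongly_measurable Bf.
apply/lee_addgt0Pr => e e0.
have [s [ms sf sv]] := bochner_approx Bf (divr_gt0 e0 (ltr0n R 2)).
have mse := strongly_measurable_simple mu ms.
have h : (L1 (simple_eval s) <= L1 f + (e / 2)%:E)%E.
  apply: le_trans (leeD2l _ (ltW sf)).
  have := le_L1D mf (strongly_measurableB mse mf).
  have -> : f \+ (fun t => simple_eval s t - f t) = simple_eval s.
    by apply/funext => t /=; rewrite addrC subrK.
  congr (_ <= _ + _)%E; apply: eq_integral => t _.
  by rewrite distrC.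
have : ((`|simple_int mu s| + e / 2)%:E <= L1 f + e%:E)%E.
  rewrite [X in (_ + X%:E)%E](_ : e = e / 2 + e / 2); last by lra.
  rewrite EFinD [in leRHS]EFinD addeA; apply: leeD2r.
  exact: le_trans (norm_simple_int mu_fin ms) h.
apply: le_trans; rewrite lee_fin.
have := ler_normB (simple_int mu s) (simple_int mu s - v).
rewrite opprB addrC subrK; lra.
Qed.

Lemma bochnerD f g v w : bochner f v -> bochner g w ->
  bochner (f \+ g) (v + w).
Proof.
move=> Bf Bg.
have mf := bochner_strongly_measurable Bf.
have mg := bochner_strongly_measurable Bg.
case: Bf Bg => [s [ok sf L sv]] [s' [ok' sg L' sw]].
exists (fun n => s n ++ s' n); split.
- move=> n; apply/(simple_ok_setT mu_fin)/msimple_cat; exact/(simple_ok_setT mu_fin).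
- apply: filterS2 sf sg => t ft gt _; under eq_fun do rewrite simple_eval_cat.
  by apply: cvgD; [exact: ft|exact: gt].
- have mB n : strongly_measurable mu (fun t => f t - simple_eval (s n) t).
    by apply: strongly_measurableB => //; apply/strongly_measurable_simple/(simple_ok_setT mu_fin).
  have mB' n : strongly_measurable mu (fun t => g t - simple_eval (s' n) t).
    by apply: strongly_measurableB => //; apply/strongly_measurable_simple/(simple_ok_setT mu_fin).
  have LL : (fun n => L1 (fun t => f t - simple_eval (s n) t) +
     L1 (fun t => g t - simple_eval (s' n) t))%E @ \oo --> 0%E.
    by rewrite -[X in _ --> X]adde0; apply: cvgeD.
  apply: (squeeze_cvge _ (cvg_cst 0%E) LL); apply: nearW => n.
  rewrite L1_ge0 /=; apply: le_trans (le_L1D (mB n) (mB' n)).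
  rewrite le_eqVlt; apply/orP; left; apply/eqP; apply: eq_integral => t _.
  by rewrite simple_eval_cat /= opprD addrACA.
- by under eq_fun do rewrite simple_int_cat; exact: cvgD.
Qed.

Lemma bochnerZ (c : R) f v : bochner f v -> bochner (fun t => c *: f t) (c *: v).
Proof.
move=> Bf; have mf := bochner_strongly_measurable Bf.
case: Bf => [s [ok sf L sv]].
exists (fun n => simple_scale c (s n)); split.
- move=> n; apply/(simple_ok_setT mu_fin)/msimple_scale; exact/(simple_ok_setT mu_fin).
- apply: filterS sf => t ft _; under eq_fun do rewrite simple_eval_scale.
  by apply: cvgZl_tmp; exact: ft.
- have LL : (fun n => (`|c|)%:E * L1 (fun t => f t - simple_eval (s n) t))%E @ \oo --> 0%E.
    by rewrite -[X in _ --> X](mule0 (`|c|)%:E); apply: cvgeZl.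
  apply: cvg_trans LL; apply: near_eq_cvg; apply: nearW => n.
  rewrite -ge0_integralZl_EFin//.
    by apply: eq_integral => t _; rewrite simple_eval_scale -scalerBr normrZ EFinM.
  apply: measurable_normE; apply: strongly_measurableB => //.
  exact/strongly_measurable_simple/(simple_ok_setT mu_fin).
- by under eq_fun do rewrite simple_int_scale; exact: cvgZl_tmp.
Qed.

Lemma bochnerB f g v w : bochner f v -> bochner g w ->
  bochner (fun t => f t - g t) (v - w).
Proof.
move=> Bf Bg; have := bochnerD Bf (bochnerZ (-1) Bg).
rewrite scaleN1r; congr is_bochner_integral; apply/funext => t /=.
by rewrite scaleN1r.
Qed.

(** A priori the value depends on the approximating sequence, but [v - w] is an integral of the zero
    function and the norm bound forces it to vanish. *)
Lemma bochner_unique f v w : bochner f v -> bochner f w -> v = w.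
Proof.
move=> Bv Bw; apply/eqP; rewrite -subr_eq0 -normr_eq0 eq_le normr_ge0 andbT.
rewrite -lee_fin; apply: le_trans (le_norm_bochner (bochnerB Bv Bw)) _.
under eq_integral do rewrite subrr normr0.
by rewrite integral0.
Qed.

Lemma bochner_indic_cst (C : set T) (y : Y) : measurable C ->
  bochner (fun t => (\1_C t : R) *: y) (m C *: y).
Proof.
move=> mC; exists (fun=> [:: (C, y)]).
have e t : simple_eval [:: (C, y)] t = (\1_C t : R) *: y.
  by rewrite /simple_eval big_seq1.
split.
- by move=> n; apply/(simple_ok_setT mu_fin)/msimple_cons; split.
- by apply: aeW => t _; rewrite e; exact: cvg_cst.
- under eq_fun do (under eq_integral do rewrite e subrr normr0; rewrite integral0).
  exact: cvg_cst.
- by rewrite /simple_int big_seq1; exact: cvg_cst.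
Qed.

Lemma le_L1_indic (C : set T) f : measurable C -> strongly_measurable mu f ->
  (L1 (fun t => (\1_C t : R) *: f t) <= L1 f)%E.
Proof.
move=> mC mf; apply: le_L1 => //; first exact: strongly_measurable_indic.
move=> t; rewrite normrZ ler_piMl// indicE.
by case: (_ \in _); rewrite ?normr1 ?normr0.
Qed.

(* The restricted simple integrals form a Cauchy sequence. *)
Lemma bochner_restrict (C : set T) f v : measurable C -> bochner f v ->
  exists w, is_bochner_integral mu C f w.
Proof.
move=> mC Bf; have mf := bochner_strongly_measurable Bf.
case: Bf => [s [ok sf L sv]].
have ms n : msimple (s n) by exact/(simple_ok_setT mu_fin).
have mss n := strongly_measurable_simple mu (ms n).
have msC n := msimple_restrict mC (ms n).
pose u n := simple_int mu (simple_restrict C (s n)).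
have uP n k : ((`|u n - u k|)%:E <= L1 (fun t => f t - simple_eval (s n) t)
    + L1 (fun t => f t - simple_eval (s k) t))%E.
  have -> : u n - u k = simple_int mu (simple_restrict C (s n) ++
     simple_scale (-1) (simple_restrict C (s k))).
    by rewrite simple_int_cat simple_int_scale scaleN1r.
  apply: le_trans (norm_simple_int mu_fin _) _.
    by apply: msimple_cat => //; exact: msimple_scale.
  have -> : simple_eval (simple_restrict C (s n) ++
     simple_scale (-1) (simple_restrict C (s k))) =
     (fun t => (\1_C t : R) *: (simple_eval (s n) t - simple_eval (s k) t)) :> (T -> Y).
    apply/funext => t; rewrite simple_eval_cat simple_eval_scale.
    by rewrite !simple_eval_restrict scaleN1r scalerBr.
  apply: le_trans (le_L1_indic mC (strongly_measurableB (mss n) (mss k))) _.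
  rewrite addeC.
  apply: le_trans (le_trans (le_L1D (strongly_measurableB mf (mss k)) (strongly_measurableB (mss n) mf)) _).
    rewrite le_eqVlt; apply/orP; left; apply/eqP; apply: eq_integral => t _ /=.
    have E (x y z : Y) : x - y + (z - x) = z - y by rewrite addrC addrA subrK.
    by rewrite E.
  rewrite leeD2l// le_eqVlt; apply/orP; left; apply/eqP.
  by apply: eq_integral => t _; rewrite distrC.
have : cvg (u @ \oo).
  apply: cauchy_cvg; apply: cauchy_exP => e e0.
  have h : \forall n \near \oo, (L1 (fun t => f t - simple_eval (s n) t) < (e / 2)%:E)%E.
    by apply: cvge0_near_lt => //; rewrite divr_gt0.
  case: h => n0 _ h; exists (u n0), n0 => // n n0n.
  rewrite /= -ball_normE /=.
  rewrite -lte_fin; apply: le_lt_trans (uP _ _) _.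
  rewrite [X in (_ < X%:E)%E](_ : e = e / 2 + e / 2); last by lra.
  by rewrite EFinD; apply: lteD; apply: h => //=.
move=> /cvg_ex[w uw]; exists w; exists (fun n => simple_restrict C (s n)); split.
- move=> n; apply/(simple_okP mu_fin) => p /mapP[q /ms mq ->].
  by split; [exact: measurableI|exact: subIsetr].
- apply: filterS sf => t /(_ I) ft Ct.
  under eq_fun do rewrite simple_eval_restrict indicE mem_set// scale1r.
  exact: ft.
- apply: (squeeze_cvge _ (cvg_cst 0%E) L); apply: nearW => n; apply/andP; split.
    by apply: integral_ge0 => t _; rewrite lee_fin.
  rewrite (@eq_integral _ _ _ mu C (fun t => (`|f t - simple_eval (s n) t|)%:E)).
    apply: ge0_subset_integral => //.
    exact/measurable_normE/strongly_measurableB.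
  by move=> t Ct; rewrite simple_eval_restrict indicE Ct scale1r.
- exact: uw.
Qed.

(** The approximants live on subsets of [S] and so vanish outside it. This and the converse below
    let all computations be made over the whole space with indicators. *)
Lemma bochner_setT (S : set T) f v : measurable S ->
  is_bochner_integral mu S f v -> bochner (fun t => (\1_S t : R) *: f t) v.
Proof.
move=> mS [s [ok sf L sv]].
have s0 n t : ~ S t -> simple_eval (s n) t = 0.
  move=> nSt; rewrite /simple_eval big_seq big1// => p ps.
  have [_ pS] := (simple_okP mu_fin S (s n)).1 (ok n) _ ps.
  by rewrite indicE memNset ?scale0r// => /pS.
exists s; split => //.
- move=> n; apply/(simple_ok_setT mu_fin) => p ps.
  by have [] := (simple_okP mu_fin S (s n)).1 (ok n) _ ps.
- apply: filterS sf => t ft _; have [St|nSt] := pselect (S t).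
    by rewrite indicE mem_set// scale1r; exact: ft.
  rewrite indicE memNset// scale0r; under eq_fun do rewrite s0//.
  exact: cvg_cst.
- apply: cvg_trans L; apply: near_eq_cvg; apply: nearW => n.
  rewrite integral_mkcond; apply: eq_integral => t _; rewrite patchE indicE.
  case: ifPn => tS; first by rewrite scale1r.
  by rewrite scale0r s0 ?subrr ?normr0//; move: tS; rewrite notin_setE.
Qed.

Lemma eq_bochner (S : set T) f g v : {in S, f =1 g} ->
  is_bochner_integral mu S f v -> is_bochner_integral mu S g v.
Proof.
move=> fg [s [ok sf L sv]]; exists s; split => //.
- by apply: filterS sf => t ft St; rewrite -fg ?inE//; exact: ft.
- apply: cvg_trans L; apply: near_eq_cvg; apply: nearW => n.
  by apply: eq_integral => t St; rewrite fg.
Qed.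

(** Restriction provides some integral over [S]; extended back to the whole space it must be [v] by
    uniqueness. *)
Lemma bochner_of_setT (S : set T) f v : measurable S ->
  bochner (fun t => (\1_S t : R) *: f t) v -> is_bochner_integral mu S f v.
Proof.
move=> mS Bf; have [w Bw] := bochner_restrict mS Bf.
have Bfw : is_bochner_integral mu S f w.
  by apply: eq_bochner Bw => t tS; rewrite indicE tS scale1r.
by rewrite (bochner_unique Bf (bochner_setT mS Bfw)).
Qed.

Definition bint f : Y := xget 0 (is_bochner_integral mu setT f).
Local Notation integ := (bochner_integrable mu setT).

Lemma bintP f : integ f -> bochner f (bint f).
Proof. by case=> v Bv; apply: xgetPex; exists v. Qed.

Lemma bintE f v : bochner f v -> bint f = v.
Proof. by move=> Bv; apply: (bochner_unique (bintP _) Bv); exists v. Qed.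

Lemma integD f g : integ f -> integ g -> integ (fun t => f t + g t).
Proof. by move=> [v Bf] [w Bg]; exists (v + w); exact: bochnerD. Qed.

Lemma integB f g : integ f -> integ g -> integ (fun t => f t - g t).
Proof. by move=> [v Bf] [w Bg]; exists (v - w); exact: bochnerB. Qed.

Lemma integZ c f : integ f -> integ (fun t => c *: f t).
Proof. by move=> [v Bf]; exists (c *: v); exact: bochnerZ. Qed.

Lemma integ_indic (C : set T) f : measurable C -> integ f ->
  integ (fun t => (\1_C t : R) *: f t).
Proof.
move=> mC [v Bf]; have [w Bw] := bochner_restrict mC Bf.
by exists w; exact: bochner_setT.
Qed.

Lemma integ_indic_cst (C : set T) (y : Y) : measurable C ->
  integ (fun t => (\1_C t : R) *: y).
Proof. by move=> mC; exists (m C *: y); exact: bochner_indic_cst. Qed.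

Lemma bintD f g : integ f -> integ g -> bint (fun t => f t + g t) = bint f + bint g.
Proof. by move=> f1 g1; apply: bintE; apply: bochnerD; exact: bintP. Qed.

Lemma bintB f g : integ f -> integ g -> bint (fun t => f t - g t) = bint f - bint g.
Proof. by move=> f1 g1; apply: bintE; apply: bochnerB; exact: bintP. Qed.

Lemma bintZ c f : integ f -> bint (fun t => c *: f t) = c *: bint f.
Proof. by move=> f1; apply: bintE; apply: bochnerZ; exact: bintP. Qed.

Lemma bint_indic_cst (C : set T) (y : Y) : measurable C ->
  bint (fun t => (\1_C t : R) *: y) = m C *: y.
Proof. by move=> mC; apply: bintE; exact: bochner_indic_cst. Qed.

Lemma integ_sum (I : Type) (r : seq I) (h : I -> T -> Y) :
  (forall i, integ (h i)) -> integ (fun t => \sum_(i <- r) h i t) /\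
  bint (fun t => \sum_(i <- r) h i t) = \sum_(i <- r) bint (h i).
Proof.
move=> ih.
have z : bochner (fun=> 0 : Y) (0 : Y).
  have -> : (fun=> 0) = (fun t => (\1_set0 t : R) *: (0 : Y)) :> (T -> Y).
    by apply/funext => t; rewrite scaler0.
  by have := bochner_indic_cst (0 : Y) measurable0; rewrite scaler0.
elim: r => [|i r [IH1 IH2]].
  under eq_fun do rewrite big_nil.
  by split; [exists 0|rewrite big_nil; exact: bintE].
have -> : (fun t => \sum_(j <- i :: r) h j t) = (fun t => h i t + \sum_(j <- r) h j t).
  by apply/funext => t; rewrite big_cons.
by split; [exact: integD|rewrite bintD// IH2 big_cons].
Qed.

Lemma le_norm_bint f : integ f -> ((`|bint f|)%:E <= L1 f)%E.
Proof. by move=> /bintP/le_norm_bochner. Qed.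

Lemma integ_smeas f : integ f -> strongly_measurable mu f.
Proof. by move=> [v]; exact: bochner_strongly_measurable. Qed.

Lemma ae_eq_bint f g : integ f -> integ g -> {ae mu, forall t, f t = g t} ->
  bint f = bint g.
Proof.
move=> f1 g1 fg; apply/eqP; rewrite -subr_eq0 -bintB// -normr_eq0 eq_le normr_ge0 andbT.
have i1 := integB f1 g1.
rewrite -lee_fin; apply: le_trans (le_norm_bint i1) _.
rewrite (@ae_eq_integral _ _ _ mu setT (cst 0%E))//; first by rewrite integral_cst// mul0e.
- exact/measurable_normE/integ_smeas.
- by apply: filterS fg => t -> _; rewrite subrr normr0.
Qed.

Lemma bint_ae0 f : integ f -> {ae mu, forall t, f t = 0} -> bint f = 0.
Proof.
move=> f1 f0; have := bint_indic_cst (0 : Y) measurable0; rewrite scaler0 => <-.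
apply: ae_eq_bint => //; first exact: integ_indic_cst.
by apply: filterS f0 => t ->; rewrite scaler0.
Qed.

(* An approximate Lyapunov theorem: exact convexity fails in infinite
   dimension, but the simple approximants are handled exactly by
   [atomless_proportional] applied to the sets they involve. *)
Lemma atomless_proportional_bint (I : finType) (h : I -> T -> Y)
  (l : seq (set T)) (C : set T) (lam e : R) :
  atomless mu -> (forall i, integ (h i)) -> {in l, forall P, measurable P} ->
  measurable C -> 0 <= lam <= 1 -> 0 < e ->
  exists B, [/\ measurable B, B `<=` C, m B = lam * m C,
    {in l, forall P, m (B `&` P) = lam * m (C `&` P)} &
    forall i, `|bint (fun t => (\1_B t : R) *: h i t) -
      lam *: bint (fun t => (\1_C t : R) *: h i t)| <= e].
Proof.
move=> mu_at ih ml mC lam01 e0.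
have /choice[s Hs] : forall i, exists s : simple, msimple s /\
    (L1 (fun t => h i t - simple_eval s t) < (e / 2)%:E)%E.
  move=> i; have [s [ms h1 _]] := bochner_approx (bintP (ih i)) (divr_gt0 e0 (ltr0n R 2)).
  by exists s.
(* The sets of all the approximants join [l], so for these simple functions the proportion [lam] is
   exact. *)
pose l' := l ++ flatten [seq [seq p.1 | p <- s i] | i <- enum I].
have ml' : {in l', forall P, measurable P}.
  move=> P; rewrite mem_cat => /orP[/ml//|/flattenP[L /mapP[i _ ->] /mapP[p ps ->]]].
  by have [ms _] := Hs i; exact: ms.
have [B [mB BC mBC pB]] := atomless_proportional mu_fin mu_at ml' mC lam01.
exists B; split => //.
  by move=> P Pl; apply: pB; rewrite mem_cat Pl.
move=> i; have [ms hs] := Hs i.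
have mse := strongly_measurable_simple mu ms.
have Bse (D : set T) : measurable D -> bochner (fun t => (\1_D t : R) *: simple_eval (s i) t)
    (\sum_(p <- s i) m (D `&` p.1) *: p.2).
  move=> mD; exists (fun=> simple_restrict D (s i)); split.
  - by move=> n; apply/(simple_ok_setT mu_fin); exact: msimple_restrict.
  - by apply: aeW => t _; rewrite simple_eval_restrict; exact: cvg_cst.
  - under eq_fun do (under eq_integral do rewrite simple_eval_restrict subrr normr0; rewrite integral0).
    exact: cvg_cst.
  - rewrite /simple_int big_map; under eq_bigr do rewrite setIC.
    exact: cvg_cst.
have bse : bint (fun t => (\1_B t : R) *: simple_eval (s i) t) =
    lam *: bint (fun t => (\1_C t : R) *: simple_eval (s i) t).
  rewrite (bintE (Bse _ mB)) (bintE (Bse _ mC)) scaler_sumr; apply: eq_big_seq => p ps.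
  rewrite pB ?scalerA// mem_cat; apply/orP; right; apply/flattenP.
  exists [seq p.1 | p <- s i]; last exact: map_f.
  by apply: map_f; rewrite mem_enum.
have close (D : set T) : measurable D ->
    `|bint (fun t => (\1_D t : R) *: h i t) - bint (fun t => (\1_D t : R) *: simple_eval (s i) t)| <= e / 2.
  move=> mD.
  have i1 : integ (fun t => (\1_D t : R) *: simple_eval (s i) t).
    by eexists; exact: Bse.
  have i2 := integ_indic mD (ih i).
  rewrite -bintB// -lee_fin; apply: le_trans (le_norm_bint (integB i2 i1)) _.
  apply: le_trans (ltW hs).
  have := le_L1_indic mD (strongly_measurableB (integ_smeas (ih i)) mse).
  by under eq_integral do rewrite scalerBr.
(* The simple parts cancel; what remains is one approximation error on [B] and [lam] times one on
   [C], each at most [e / 2]. *)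
have := close B mB; have := close C mC; rewrite bse.
set x := bint _; set y := bint _; set z := bint _ => h1 h2.
have -> : z - lam *: x = (z - lam *: y) - lam *: (x - y).
  by rewrite scalerBr opprB addrA subrK.
apply: le_trans (ler_normB _ _) _; rewrite normrZ.
have /andP[l0 l1] := lam01; rewrite ger0_norm//.
have : lam * `|x - y| <= 1 * `|x - y| by rewrite ler_wpM2r.
by rewrite mul1r; lra.
Qed.

Lemma L1_indic_cvg0 f (C : nat -> set T) : integ f -> (forall n, measurable (C n)) ->
  {ae mu, forall t, \forall n \near \oo, ~ C n t} ->
  (fun n => L1 (fun t => (\1_(C n) t : R) *: f t)) @ \oo --> 0%E.
Proof.
move=> fi mC C0.
have [v Bv] := fi.
have mf := integ_smeas fi.
have [] := @dominated_convergence _ _ _ mu setT measurableT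
  (fun n t => (`|(\1_(C n) t : R) *: f t|)%:E) (cst 0%E) (fun t => (`|f t|)%:E).
- by move=> n; exact/measurable_normE/strongly_measurable_indic.
- exact: measurable_cst.
- apply: filterS C0 => t Ct _; apply: cvg_near_cst.
  by apply: filterS Ct => n nC; rewrite indicE memNset// scale0r normr0.
- apply/integrableP; split; first exact: measurable_normE.
  by under eq_integral do rewrite abse_EFin normr_id; exact: L1_fin Bv.
- apply: aeW => t n _; rewrite abse_EFin normr_id lee_fin normrZ ler_piMl// indicE.
  by case: (_ \in _); rewrite ?normr1 ?normr0.
- by move=> _ _; rewrite integral_cst// mul0e.
Qed.

End BochnerIntegral.

(** * Cones, information and the choice of the coalition *)

Section Cone.
Context {R : realType} {Y : completeNormedModType R}.
Variable K : set Y.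
Hypothesis K_scale : forall (c : R) x, 0 <= c -> K x -> K (c *: x).

Lemma interior_ball (e : Y) : K° e ->
  exists2 rho : R, 0 < rho & forall x, `|x| < rho -> K (e + x).
Proof.
move=> /nbhs_normP[rho rho0 h]; exists rho => // x xr; apply: h.
by rewrite /= opprD addNKr normrN.
Qed.

Lemma ball_interior (e : Y) (rho : R) : 0 < rho ->
  (forall x, `|x| < rho -> K (e + x)) -> K° e.
Proof.
move=> rho0 h; apply/nbhs_normP; exists rho => // y /= yr.
by rewrite -(subrK e y) addrC; apply: h; rewrite distrC.
Qed.

(** By homogeneity the cone contains the open ball of radius [tau * rho] around [tau *: e], and the
    room left by [x] serves as a radius. *)
Lemma interior_cone_shift (e x : Y) (rho tau : R) : 0 < tau ->
  (forall x, `|x| < rho -> K (e + x)) -> `|x| < tau * rho -> K° (tau *: e + x).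
Proof.
move=> tau0 h xt; have p0 : 0 < tau * rho - `|x| by rewrite subr_gt0.
apply: (ball_interior p0) => y yp.
have -> : tau *: e + x + y = tau *: (e + tau^-1 *: (x + y)).
  by rewrite scalerDr scalerA divff ?gt_eqF// scale1r addrA.
apply: K_scale; first exact: ltW.
apply: h; rewrite normrZ gtr0_norm ?invr_gt0// ltr_pdivrMl//.
apply: le_lt_trans (ler_normD _ _) _; lra.
Qed.

End Cone.

Section BlockConstant.
Context {Omega : finType} {R : realType} {Y : completeNormedModType R}.

Definition block_constant (P : {set {set Omega}}) (x : Omega -> Y) :=
  forall B w w', B \in P -> w \in B -> w' \in B -> x w = x w'.

(** Points of [Y] are closed, so testing measurability on the complement of [[set x w]] forces a
    single value on the block of [w]. *)
Lemma P_measurable_block_constant P x :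
  P_measurable P x <-> block_constant P x.
Proof.
split=> [mx B w w' BP wB w'B|cx O _ B BP].
  have oO : open (~` [set x w]).
    by apply: closed_openC; apply: accessible_closed_set1; exact: hausdorff_accessible.
  case: (mx _ oO B BP) => h; first by exfalso; exact: (h w wB erefl).
  by apply: contrapT => ne; apply: (h w' w'B) => /esym.
have [[w [wB Ow]]|nO] := pselect (exists w, w \in B /\ O (x w)).
  by left => w' w'B; rewrite /preimage/= (cx B w' w).
by right => w wB Ow; apply: nO; exists w.
Qed.

End BlockConstant.

(** The bound is the inverse of 1 plus the sum of the inverses: null terms add nothing, as the
    inverse of 0 is 0, and the 1 covers the case where all vanish. It serves to bound below the
    measures of all non-null information types at once. *)
Lemma lower_bound_nonzero (R : realType) (I : finType) (x : I -> R) :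
  (forall i, 0 <= x i) ->
  exists2 c : R, 0 < c & forall i, x i != 0 -> c <= x i.
Proof.
move=> x0; pose s := 1 + \sum_i (x i)^-1.
have s0 : 0 < s by rewrite ltr_pwDl// sumr_ge0// => i _; rewrite invr_ge0.
exists s^-1; first by rewrite invr_gt0.
move=> i xi; have xi0 : 0 < x i by rewrite lt_neqAle eq_sym xi x0.
rewrite -[leRHS]invrK lef_pV2 ?posrE ?invr_gt0// /s (bigD1 i)//= addrCA.
by rewrite ler_wpDr// addr_ge0// sumr_ge0// => j _; rewrite invr_ge0.
Qed.

Section Selection.
Context {R : realType} {d : measure_display} {T : measurableType d}
  {Y : completeNormedModType R}.
Variable mu : {measure set T -> \bar R}.
Hypothesis mu_fin : (mu setT < +oo)%E.
Hypothesis mu_complete : measure_is_complete mu.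
Hypothesis mu_atomless : atomless mu.
Local Notation m := (rmeas mu).
Local Notation integ := (bochner_integrable mu setT).

(** The approximate Lyapunov theorem is applied separately to [A] and to its complement, with error
    [e / 2] each, to the functions indexed by pairs of a type and a state. *)
Lemma atomless_two_rates (I J : finType) (P : I -> set T) (h : J -> T -> Y)
  (A : set T) (l1 l2 e : R) :
  (forall i, measurable (P i)) -> (forall j, integ (h j)) -> measurable A ->
  0 <= l1 <= 1 -> 0 <= l2 <= 1 -> 0 < e ->
  exists S, [/\ measurable S, m S = l1 * m A + l2 * m (~` A),
    forall i, m (S `&` P i) = l1 * m (A `&` P i) + l2 * m (~` A `&` P i) &
    forall i j, `|bint mu (fun t => (\1_S t : R) *: ((\1_(P i) t : R) *: h j t)) -
      l1 *: bint mu (fun t => (\1_A t : R) *: ((\1_(P i) t : R) *: h j t)) -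
      l2 *: bint mu (fun t => (\1_(~` A) t : R) *: ((\1_(P i) t : R) *: h j t))|
      <= e].
Proof.
move=> mP ih mA l1P l2P e0.
have ihP (ij : I * J) : integ (fun t => (\1_(P ij.1) t : R) *: h ij.2 t).
  exact: integ_indic.
pose l := [seq P i | i <- enum I].
have ml : {in l, forall Q, measurable Q} by move=> _ /mapP[i _ ->].
have Pl i : P i \in l by apply: map_f; rewrite mem_enum.
have e20 : 0 < e / 2 by rewrite divr_gt0.
have mAc : measurable (~` A) by exact: measurableC.
have [S1 [mS1 S1A m1 p1 b1]] :=
  atomless_proportional_bint mu_fin mu_complete mu_atomless ihP ml mA l1P e20.
have [S2 [mS2 S2A m2 p2 b2]] :=
  atomless_proportional_bint mu_fin mu_complete mu_atomless ihP ml mAc l2P e20.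
have S120 : S1 `&` S2 = set0.
  by apply/seteqP; split => // t [/S1A ? /S2A].
exists (S1 `|` S2); split.
- exact: measurableU.
- by rewrite rmeasU// m1 m2.
- move=> i; rewrite setIUl rmeasU ?p1 ?p2//; try exact: measurableI.
  by rewrite setIACA S120 set0I.
move=> i j.
have -> : (fun t => (\1_(S1 `|` S2) t : R) *: ((\1_(P i) t : R) *: h j t)) =
    (fun t => (\1_S1 t : R) *: ((\1_(P i) t : R) *: h j t) +
              (\1_S2 t : R) *: ((\1_(P i) t : R) *: h j t)).
  apply/funext => t; rewrite -scalerDl; congr (_ *: _); rewrite !indicE.
  have [t1|t1] := pselect (S1 t).
    rewrite (mem_set t1) mem_set; last by left.
    by rewrite memNset ?addr0// => t2; have : set0 t by rewrite -S120.
  rewrite (memNset t1) add0r; congr (nat_of_bool _)%:R.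
  by apply/idP/idP; rewrite !inE; [case|right].
have i1 := integ_indic mu_fin mu_complete mS1 (ihP (i, j)).
have i2 := integ_indic mu_fin mu_complete mS2 (ihP (i, j)).
rewrite bintD//.
have := b1 (i, j); have := b2 (i, j) => /= h2 h1.
rewrite [leRHS](_ : e = e / 2 + e / 2); last by lra.
apply: le_trans (lerD h1 h2); apply: le_trans (ler_normD _ _).
by rewrite [in leRHS]addrACA addrA.
Qed.

End Selection.

(** * Economies *)

Section Economy.
Context {R : realType} {Omega : finType} {d : measure_display}
  {T : measurableType d} {Y : completeNormedModType R}.
Variables (mu : {measure set T -> \bar R}) (K : set Y).
Hypothesis mu_fin : (mu setT < +oo)%E.
Hypothesis mu_complete : measure_is_complete mu.
Local Notation m := (rmeas mu).
Local Notation integ := (bochner_integrable mu setT).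
Local Notation L1 f := (\int[mu]_t (`|f t|)%:E)%E.

(** With finitely many states, each agent of [A] can give up [e] divided by some [n.+1] in every
    state. So [A] is the union of the sets [E n], and one of them is not null. They are defined by
    the interior of [K], whose openness makes them measurable. *)
Lemma endowment_margin (a : T -> Omega -> Y) (A : set T) (e : Y) :
  (forall w, integ (a ^~ w)) -> (forall t w, K° (a t w)) -> measurable A ->
  0 < m A ->
  exists E r, [/\ measurable E, E `<=` A, 0 < m E, 0 < r &
    forall t w, E t -> K (a t w - r *: e)].
Proof.
move=> ia Ka mA A0.
pose E n := A `&` [set t | forall w, K° (a t w - n.+1%:R^-1 *: e)].
have mE n : measurable (E n).
  apply: measurableI => //.
  rewrite (_ : [set t | _] = \bigcap_(w in [set: Omega])
      (fun t => a t w - n.+1%:R^-1 *: e) @^-1` K°).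
    apply: fin_bigcap_measurable => [|w _]; first exact: finite_finset.
    apply: (measurable_preimage_open mu_complete); last exact: open_interior.
    apply: (@integ_smeas _ _ _ _ mu mu_fin); apply: integB => //.
    have := integ_indic_cst mu_fin (n.+1%:R^-1 *: e) (@measurableT _ T).
    by congr bochner_integrable; apply/funext => t; rewrite indicT scale1r.
  by apply/seteqP; split => t h w; [move=> _; exact: h|exact: h].
have [n En] : exists n, 0 < m (E n).
  apply: contrapT => h.
  have E0 n : mu.-negligible (E n).
    apply/negligibleP => //; apply: (etrans (rmeasE mu_fin (mE n))); congr EFin.
    have := rmeas_ge0 mu (E n); rewrite le_eqVlt => /orP[/eqP ->//|En].
    by exfalso; apply: h; exists n.
  have : mu.-negligible A.
    apply: negligibleS (negligible_bigcup E0) => t At.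
    have : \forall n \near \oo, forall w, K° (a t w - n.+1%:R^-1 *: e).
      apply: filter_forall => w.
      have c : (fun n => a t w - n.+1%:R^-1 *: e) @ \oo --> a t w.
        rewrite -[X in _ --> X]subr0; apply: cvgB; first exact: cvg_cst.
        rewrite -[X in _ --> X](scale0r e); apply: cvgZr_tmp; exact: cvg_harmonic.
      by apply: c; apply: open_nbhs_nbhs; split; [exact: open_interior|exact: Ka].
    move=> [n _ hn]; exists n => //; split => //; exact: hn (leqnn n).
  move=> nA; have A00 : m A = 0 by apply: EFin_inj; rewrite -rmeasE//; apply/negligibleP.
  by rewrite A00 ltxx in A0.
exists (E n), n.+1%:R^-1; split => //; first exact: subIsetl.
by move=> t w [_ Et]; apply: interior_subset; exact: Et.
Qed.

Variables (U : T -> Omega -> Y -> R) (q : T -> Omega -> R).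
Hypothesis U_meas : forall w x, K x -> measurable_fun setT (fun t => U t w x).
Hypothesis U_cont : forall t w, {within K, continuous (U t w)}.
Hypothesis q_meas : forall w, measurable_fun setT (fun t => q t w).

Definition expected_utility t (x : Omega -> Y) : R :=
  \sum_(w : Omega) U t w (x w) * q t w.
Local Notation V := expected_utility.

Lemma measurable_expected_utility (x : T -> Omega -> Y) :
  (forall w, integ (x ^~ w)) -> (forall t w, K (x t w)) ->
  measurable_fun setT (fun t => V t (x t)).
Proof.
move=> ix Kx; apply: measurable_sum => w; apply: measurable_funM => //.
apply: (@measurable_caratheodory _ _ _ _ mu mu_complete K (fun t => U t w) (x ^~ w)) => //.
- exact: integ_smeas (ix w).
- by move=> y; exact: U_meas.
Qed.

(** As the weight [c n] tends to 0, the mixed utility tends to that of [g], so almost every agent of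
    [A] lies in [D n] for all large [n], and dominated convergence makes what is lost on the rest of
    [A] small. Utilities are mixed here, not bundles; concavity makes the passage later. *)
Lemma eventual_improvement (A E : set T) (f g a b : T -> Omega -> Y) (delta : R) :
  measurable A -> measurable E -> E `<=` A -> 0 < m E -> 0 < delta ->
  (forall w, integ (f ^~ w)) -> (forall t w, K (f t w)) ->
  (forall w, integ (g ^~ w)) -> (forall t w, K (g t w)) ->
  (forall w, integ (b ^~ w)) -> (forall t w, K (b t w)) ->
  (forall w, integ (a ^~ w)) ->
  {ae mu, forall t, A t -> V t (f t) < V t (g t)} ->
  exists D c, [/\ measurable D /\ D `<=` A, 0 < c <= 1, m E / 2 <= m (D `&` E),
    (forall w, L1 (fun t => (\1_(A `\` D) t : R) *: (g t w - a t w)) < delta%:E)%E &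
    forall t, D t -> V t (f t) < (1 - c) * V t (g t) + c * V t (b t)].
Proof.
move=> mA mE EA E0 delta0 fi Kf gi Kg bi Kb ai fg.
pose c n : R := n.+1%:R^-1.
have c01 n : 0 < c n <= 1.
  by rewrite /c invr_gt0 ltr0n /= invf_le1 ?ltr0n// ler1n.
pose H n t := (1 - c n) * V t (g t) + c n * V t (b t) - V t (f t).
pose D n := A `&` [set t | 0 < H n t].
have mH n : measurable_fun setT (H n).
  apply: measurable_funB; last exact: measurable_expected_utility.
  by apply: measurable_funD; apply: measurable_funM => //; exact: measurable_expected_utility.
have mD n : measurable (D n).
  apply: measurableI => //.
  rewrite (_ : [set t | _] = setT `&` (H n) @^-1` `]0, +oo[%classic).
    by apply: (mH n) => //; exact: measurable_itv.
  by rewrite setTI; apply/seteqP; split => t /=; rewrite in_itv/= andbT.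
have ev : {ae mu, forall t, \forall n \near \oo, ~ (A `\` D n) t}.
  apply: filterS fg => t fgt; have [At|nAt] := pselect (A t); last first.
    by apply: nearW => n [].
  have cvH : H ^~ t @ \oo --> V t (g t) - V t (f t).
    apply: cvgB; last exact: cvg_cst.
    rewrite [X in _ --> X](_ : _ = (1 - 0) * V t (g t) + 0 * V t (b t)); last by lra.
    apply: cvgD; apply: cvgMr_tmp; last exact: cvg_harmonic.
    by apply: cvgB; [exact: cvg_cst|exact: cvg_harmonic].
  have : \forall n \near \oo, 0 < H n t.
    by apply: (cvgr_gt _ cvH); rewrite subr_gt0; exact: fgt.
  by apply: filterS => n Hn [_]; apply; split.
have mAD n : measurable (A `\` D n) by exact: measurableD.
have ev1 : \forall n \near \oo, forall w,
    (L1 (fun t => (\1_(A `\` D n) t : R) *: (g t w - a t w)%R) < delta%:E)%E.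
  apply: filter_forall => w; apply: cvge0_near_lt => //.
  by apply: L1_indic_cvg0 => //; exact: integB.
have ev2 : \forall n \near \oo, m (A `\` D n) < m E / 2.
  (* Applied to the constant 1 in [R^o], the same convergence bounds the measure of the discarded
     agents. *)
  have i1 : bochner_integrable mu setT (fun=> 1 : R^o).
    have := integ_indic_cst mu_fin (1 : R^o) (@measurableT _ T).
    by congr bochner_integrable; apply/funext => t; rewrite indicT scale1r.
  have := L1_indic_cvg0 mu_fin mu_complete i1 mAD ev.
  move=> /cvge0_near_lt /(_ (divr_gt0 E0 (ltr0n R 2))).
  apply: filterS => n; rewrite -lte_fin; apply: le_lt_trans.
  have := le_norm_bint mu_fin mu_complete (integ_indic_cst mu_fin (1 : R^o) (mAD n)).
  by rewrite bint_indic_cst// normrZ normr1 mulr1 ger0_norm ?rmeas_ge0.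
have [n [ev1n ev2n]] : exists n, (forall w,
    (L1 (fun t => (\1_(A `\` D n) t : R) *: (g t w - a t w)%R) < delta%:E)%E) /\
    m (A `\` D n) < m E / 2.
  by near \oo => n; exists n; split; near: n.
exists (D n), (c n); split => //.
- by split => // t [].
- have := rmeasID mu_fin (mD n) mE; rewrite (setIC E).
  have : m (E `\` D n) <= m (A `\` D n).
    by apply: le_rmeas => //; [exact: measurableD|exact: setSD].
  lra.
- by move=> t [_]; rewrite /= /H subr_gt0.
Unshelve. all: by end_near. Qed.

End Economy.

(** * Clearing the market by transfers that depend only on the information type *)

Section Transfers.
Context {R : realType} {J : finType} {d : measure_display}
  {T : measurableType d} {Y : completeNormedModType R}.
Variables (mu : {measure set T -> \bar R}) (Pi : T -> J).
Hypothesis mu_fin : (mu setT < +oo)%E.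
Hypothesis mu_complete : measure_is_complete mu.
Local Notation m := (rmeas mu).
Local Notation integ := (bochner_integrable mu setT).
Definition fiber Q : set T := [set t | Pi t = Q].
Hypothesis fiber_measurable : forall Q, measurable (fiber Q).

Lemma sum_fiber t (F : J -> Y) :
  \sum_Q (\1_(fiber Q) t : R) *: F Q = F (Pi t).
Proof.
rewrite (bigD1 (Pi t))//= big1 ?addr0; first by rewrite indicE mem_set// scale1r.
by move=> Q /eqP Qt; rewrite indicE memNset ?scale0r// => /= /esym.
Qed.

Lemma bint_sum_fiber (h : T -> Y) : integ h ->
  \sum_Q bint mu (fun t => (\1_(fiber Q) t : R) *: h t) = bint mu h.
Proof.
move=> ih; have [_ <-] := integ_sum mu_fin mu_complete (index_enum J)
   (fun Q => integ_indic mu_fin mu_complete (fiber_measurable Q) ih).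
by congr bint; apply/funext => t; rewrite (sum_fiber t (fun=> h t)).
Qed.

Variables (S : set T) (h psi : T -> Y) (tau : R) (e : Y).
Hypothesis S_measurable : measurable S.
Hypothesis h_integ : integ h.
Hypothesis psi_integ : integ psi.
Hypothesis S_fiber : forall Q, m (S `&` fiber Q) = 0 -> m (fiber Q) = 0.
Hypothesis psi_total : bint mu psi = - ((tau * m S) *: e).

(** The integral of [psi] over the whole fiber is the predicted net demand of type [Q]; the
    imbalance is how far the members of [S] of that type depart from it. *)
Definition imbalance Q :=
  bint mu (fun t => (\1_S t : R) *: ((\1_(fiber Q) t : R) *: h t)) -
  bint mu (fun t => (\1_(fiber Q) t : R) *: psi t).

(* On a null fiber of S the inverse is 0 and the transfer is just tau e. *)
Definition transfer Q := tau *: e - (m (S `&` fiber Q))^-1 *: imbalance Q.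

Lemma null_imbalance Q : m (fiber Q) = 0 -> imbalance Q = 0.
Proof.
move=> Q0; have ae0 : {ae mu, forall t, ~ fiber Q t}.
  exists (fiber Q); split => //.
    by apply: etrans (rmeasE mu_fin (fiber_measurable Q)) _; rewrite Q0.
  by move=> t /= /contrapT.
have i1 := integ_indic mu_fin mu_complete S_measurable
  (integ_indic mu_fin mu_complete (fiber_measurable Q) h_integ).
have i2 := integ_indic mu_fin mu_complete (fiber_measurable Q) psi_integ.
rewrite /imbalance !bint_ae0 ?subr0//.
  by apply: filterS ae0 => t tQ; rewrite (indicE _ (fiber Q)) memNset// scale0r.
by apply: filterS ae0 => t tQ; rewrite (indicE _ (fiber Q)) memNset// scale0r scaler0.
Qed.

(** Weighted by the measures of the fibers in [S], the terms in [e] add up to minus the integral of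
    [psi], while the imbalances add up to the integral of [h] over [S] minus that of [psi]. The
    difference is exactly what clears [S]. *)
Lemma transfer_integ : integ (fun t => transfer (Pi t)) /\
  bint mu (fun t => (\1_S t : R) *: transfer (Pi t)) =
  - bint mu (fun t => (\1_S t : R) *: h t).
Proof.
have mSQ Q : measurable (S `&` fiber Q) by exact: measurableI.
have [i1 _] := integ_sum mu_fin mu_complete (index_enum J)
   (fun Q => integ_indic_cst mu_fin (transfer Q) (fiber_measurable Q)).
have [_ e2] := integ_sum mu_fin mu_complete (index_enum J)
   (fun Q => integ_indic_cst mu_fin (transfer Q) (mSQ Q)).
split.
  by move: i1; congr bochner_integrable; apply/funext => t; rewrite sum_fiber.
transitivity (\sum_Q m (S `&` fiber Q) *: transfer Q).
  transitivity (bint mu (fun t => \sum_Q (\1_(S `&` fiber Q) t : R) *: transfer Q)).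
    congr bint; apply/funext => t; rewrite -sum_fiber scaler_sumr.
    by apply: eq_bigr => Q _; rewrite scalerA indicI.
  by rewrite e2; apply: eq_bigr => Q _; rewrite bint_indic_cst.
have -> : \sum_Q m (S `&` fiber Q) *: transfer Q =
    \sum_Q (m (S `&` fiber Q) * tau) *: e - \sum_Q imbalance Q.
  rewrite -sumrB; apply: eq_bigr => Q _.
  rewrite /transfer scalerBr !scalerA; congr (_ - _).
  have [Q0|Q0] := eqVneq (m (S `&` fiber Q)) 0.
    by rewrite Q0 mul0r scale0r null_imbalance//; exact: S_fiber.
  by rewrite divff// scale1r.
rewrite -scaler_suml -mulr_suml.
(* Additivity over the fibers is read off from the integral of the constant 1 in [R^o]. *)
have -> : \sum_Q m (S `&` fiber Q) = m S.
  have [_ e3] := integ_sum mu_fin mu_complete (index_enum J)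
    (fun Q => integ_indic_cst mu_fin (1 : R^o) (mSQ Q)).
  transitivity (\sum_Q bint mu (fun t => (\1_(S `&` fiber Q) t : R) *: (1 : R^o))).
    by apply: eq_bigr => Q _; rewrite bint_indic_cst// [_ *: _]mulr1.
  rewrite -e3 (_ : (fun t => _) = (fun t => (\1_S t : R) *: (1 : R^o))).
    by rewrite bint_indic_cst// [_ *: _]mulr1.
  apply/funext => t.
  rewrite (bigD1 (Pi t))//= big1 ?addr0.
    by rewrite indicI /= (indicE _ (fiber _)) mem_set// mulr1.
  by move=> Q /eqP Qt; rewrite indicI /= (indicE _ (fiber _)) memNset ?mulr0 ?scale0r// => /= /esym.
rewrite /imbalance sumrB bint_sum_fiber// psi_total.
have -> : \sum_Q bint mu (fun t => (\1_S t : R) *: ((\1_(fiber Q) t : R) *: h t)) =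
    bint mu (fun t => (\1_S t : R) *: h t).
  rewrite -(bint_sum_fiber (integ_indic mu_fin mu_complete S_measurable h_integ)).
  by apply: eq_bigr => Q _; congr bint; apply/funext => t; rewrite !scalerA mulrC.
by rewrite opprK opprD addrCA (mulrC tau) subrr addr0.
Qed.

End Transfers.

(** Here [h] is the net demand of the mixture, and the three cases are agents in [D], in the rest of
    [A], and outside [A]. The rate [lam * (1 - al)] off [A] is the one that gives [f - a] the same
    coefficient everywhere, so feasibility of [f] removes it; feasibility of [g] on [A] removes the
    second term, leaving the gain in [e] and an error on the discarded agents. *)
Lemma mixture_identity (R : realType) (Y : lmodType R) (f a g e : Y)
    (al c lam r iA iD iE : R) :
  [\/ iA = 1 /\ iD = 1, iA = 1 /\ iD = 0 | iA = 0 /\ iD = 0] ->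
  let h := f + (al * iA) *: (g - f) +
    (al * c * iD) *: (a - r *: (iE *: e) - g) - a in
  lam *: (iA *: h) + (lam * (1 - al)) *: ((1 - iA) *: h) =
  (lam * (1 - al)) *: (f - a) + (lam * al * (1 - c)) *: (iA *: (g - a)) -
  (lam * al * c * r) *: ((iD * iE) *: e) +
  (lam * al * c) *: ((iA - iD) *: (g - a)).
Proof.
(* In coordinates along [f], [a], [g], [e] the identity reduces to four scalar identities for
   [ring]. *)
pose L (p q s z : R) : Y := p *: f + q *: a + s *: g + z *: e.
have LD p q s z p' q' s' z' :
    L p q s z + L p' q' s' z' = L (p + p') (q + q') (s + s') (z + z').
  by rewrite /L !scalerDl (addrACA _ (z *: e)) (addrACA _ (s *: g)) (addrACA (p *: f)).
have LZ x p q s z : x *: L p q s z = L (x * p) (x * q) (x * s) (x * z).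
  by rewrite /L !scalerDr !scalerA.
have LN p q s z : - L p q s z = L (- p) (- q) (- s) (- z).
  by rewrite -scaleN1r LZ !mulN1r.
have ef : f = L 1 0 0 0 by rewrite /L scale1r !scale0r !addr0.
have ea : a = L 0 1 0 0 by rewrite /L scale1r !scale0r !addr0 add0r.
have eg : g = L 0 0 1 0 by rewrite /L scale1r !scale0r !addr0 !add0r.
have ee : e = L 0 0 0 1 by rewrite /L scale1r !scale0r !add0r.
move: L ef ea eg ee LD LZ LN => L -> -> -> -> LD LZ LN cases /=.
rewrite !(LN, LD, LZ).
by case: cases => -[-> ->]; congr L; ring.
Qed.

(** * The coalition of measure [eps] and its blocking allocation *)

Unset Implicit Arguments.

Theorem theorem3p9
  (R : realType) (Omega : finType) (F : set (set Omega))
  (d : measure_display) (T : measurableType d) (mu : {measure set T -> \bar R})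
  (Y : completeNormedModType R) (Yp : set Y)
  (Pi : T -> {set {set Omega}}) (U : T -> Omega -> Y -> R)
  (a : T -> Omega -> Y) (q : T -> Omega -> R)
  (* Omega with its sigma-algebra F *)
  (HF : sigma_alg_fin F)
  (* (T, Sigma, mu): complete, finite, positive measure space; atomless *)
  (Hfin : (mu setT < +oo)%E)
  (Hcomplete : measure_is_complete mu)
  (Hatomless : atomless mu)
  (* Y ordered Banach space: Yp a closed pointed convex cone, nonempty interior *)
  (Hcone_add : forall x y, Yp x -> Yp y -> Yp (x + y))
  (Hcone_scale : forall (c : R) x, 0 <= c -> Yp x -> Yp (c *: x))
  (Hcone_pointed : forall x, Yp x -> Yp (- x) -> x = 0)
  (Hcone_closed : closed Yp)
  (Hint : exists x, (Yp°) x)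
  (* agents' information: partitions into F-sets *)
  (HPi : forall t, finset.partition (Pi t) [set: Omega]%SET)
  (HPiF : forall t B, B \in Pi t -> F [set w | w \in B])
  (* priors *)
  (Hq_pos : forall t w, 0 < q t w)
  (Hq_sum : forall t, \sum_(w : Omega) q t w = 1)
  (* endowments *)
  (Ha_const : forall t B w w', B \in Pi t -> w \in B -> w' \in B -> a t w = a t w')
  (Ha_pos : forall t w, Yp (a t w))
  (Ha_int : forall w, bochner_integrable mu setT (fun t => a t w))
  (* (A1) *)
  (HA1q : forall w, measurable_fun setT (fun t => q t w))
  (HA1T : forall Q : {set {set Omega}}, finset.partition Q [set: Omega]%SET ->
            measurable [set t | Pi t = Q])
  (* (A2) *)
  (HA2meas : forall w x, Yp x -> measurable_fun setT (fun t => U t w x))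
  (HA2cont : forall t w, {within Yp, continuous (U t w)})
  (* (A3) *)
  (HA3 : forall t w x y, Yp x -> (Yp°) y -> U t w x < U t w (x + y))
  (* (A4') *)
  (HA4 : forall t w x y (l : R), Yp x -> Yp y -> 0 <= l <= 1 ->
           l * U t w x + (1 - l) * U t w y <= U t w (l *: x + (1 - l) *: y))
  (* (A5) *)
  (HA5 : forall t w, (Yp°) (a t w))
  (* V_t *)
  (V := fun t (x : Omega -> Y) => \sum_(w : Omega) U t w (x w) * q t w)
  (* S-allocations and S-exact feasibility *)
  (allocation := fun (S : set T) (g : T -> Omega -> Y) =>
     [/\ forall t w, S t -> Yp (g t w),
         forall w, bochner_integrable mu S (fun t => g t w)
       & {ae mu, forall t, S t -> P_measurable (Pi t) (g t)}])
  (exactly_feasible := fun (S : set T) (g : T -> Omega -> Y) =>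
     forall w, exists v, is_bochner_integral mu S (fun t => g t w) v /\
                         is_bochner_integral mu S (fun t => a t w) v)
  (* NY-private blocking *)
  (blocks := fun (S : set T) (f : T -> Omega -> Y) =>
     [/\ measurable S, (0 < mu S)%E &
       exists g, [/\ allocation S g, exactly_feasible S g &
                     {ae mu, forall t, S t -> V t (g t) > V t (f t)}]])
  (f : T -> Omega -> Y)
  (Hf_alloc : allocation setT f)
  (Hf_feas : exactly_feasible setT f)
  (Hf_notcore : exists S, blocks S f)
  (eps : R) (Heps0 : 0 < eps) (Heps1 : (eps%:E < mu setT)%E) :
  exists S, blocks S f /\ mu S = eps%:E.
Proof.
have if0 : forall w, bochner_integrable mu setT (f ^~ w) by have [] := Hf_alloc.
have Kf : forall t w, Yp (f t w) by move=> t w; have [h _ _] := Hf_alloc; exact: h.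
have bf : {ae mu, forall t, block_constant (Pi t) (f t)}.
  have [_ _] := Hf_alloc; apply: filterS => t /(_ I) /P_measurable_block_constant; exact.
have [A [mA A0 [g [[KgA igA bgA] gfeas gV]]]] := Hf_notcore.
pose m := rmeas mu.
have mE C : measurable C -> mu C = (m C)%:E by exact: rmeasE.
have mA0 : 0 < m A by rewrite -lte_fin -mE.
have mAc : measurable (~` A) by exact: measurableC.
have [e Ke] := Hint.
have [rho rho0 Hrho] := interior_ball Ke.
have ia := Ha_int.
(* Nothing is known of [g] off [A]. Completed by the endowment, it is integrable, cone-valued and
   compatible with information everywhere, and its net demand vanishes off [A]. *)
pose g1 t w := (\1_A t : R) *: g t w + (\1_(~` A) t : R) *: a t w.
have g1A t w : A t -> g1 t w = g t w.
  by move=> At; rewrite /g1 !indicE mem_set// memNset ?scale1r ?scale0r ?addr0// => /(_ At).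
have g1N t w : ~ A t -> g1 t w = a t w.
  by move=> At; rewrite /g1 !indicE memNset// mem_set ?scale1r ?scale0r ?add0r.
have ig w : bochner_integrable mu setT (fun t => (\1_A t : R) *: g t w).
  by have [v Bv] := igA w; exists v; exact: bochner_setT.
have ig1 w : bochner_integrable mu setT (g1 ^~ w).
  by apply: integD => //; exact: integ_indic.
have Kg1 t w : Yp (g1 t w).
  by have [At|At] := pselect (A t); [rewrite g1A//; exact: KgA|rewrite g1N].
have bg1 : {ae mu, forall t, block_constant (Pi t) (g1 t)}.
  apply: filterS bgA => t tg B w w' BP wB w'B.
  have [At|At] := pselect (A t); last by rewrite !g1N//; exact: Ha_const BP wB w'B.
  by rewrite !g1A//; exact: ((P_measurable_block_constant _ _).1 (tg At)) BP wB w'B.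
have g1V : {ae mu, forall t, A t -> V t (f t) < V t (g1 t)}.
  apply: filterS gV => t tg At; apply: lt_le_trans (tg At) _.
  by rewrite (_ : g1 t = g t)//; apply/funext => w; exact: g1A.
have ga0 w : bint mu (fun t => (\1_A t : R) *: (g1 t w - a t w)) = 0.
  have [v [gv av]] := gfeas w.
  have e1 := bintE Hfin Hcomplete (bochner_setT Hfin mA gv).
  have e2 := bintE Hfin Hcomplete (bochner_setT Hfin mA av).
  rewrite -(subrr v) -{1}e1 -e2 -bintB//; last exact: integ_indic.
  congr bint; apply/funext => t; rewrite -scalerBr.
  have [At|At] := pselect (A t); first by rewrite g1A.
  by rewrite indicE memNset// !scale0r.
have fa0 w : bint mu (fun t => f t w - a t w) = 0.
  have [v [fv av]] := Hf_feas w.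
  by rewrite bintB// (bintE _ _ fv)// (bintE _ _ av)// subrr.
have [E [r [mEm EA mE0 r0 HE]]] :=
  endowment_margin Hfin Hcomplete e ia HA5 mA mA0.
pose b t w := a t w - r *: ((\1_E t : R) *: e).
have ib w : bochner_integrable mu setT (b ^~ w).
  by apply: integB => //; apply: integZ => //; exact: integ_indic_cst.
have Kb t w : Yp (b t w).
  rewrite /b; have [Et|Et] := pselect (E t); rewrite indicE.
    by rewrite mem_set// scale1r; exact: HE.
  by rewrite memNset// scale0r scaler0 subr0.
pose M := m setT.
have epsM : eps < M by rewrite -lte_fin -mE.
have M0 : 0 < M by exact: lt_trans epsM.
have mAcM : m (~` A) <= M by exact: le_rmeas.
have mA_ge0 : 0 <= m (~` A) by exact: rmeas_ge0.
have mAAc : m A + m (~` A) = M.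
  by rewrite /M /m (rmeasID Hfin mA measurableT) setTI setTD.
(* The first bound keeps [1 - al] positive; the second ensures [eps <= W], hence [lam <= 1]. *)
pose al := Num.min (1 / 2) ((M - eps) / M).
have al0 : 0 < al by rewrite /al lt_min divr_gt0//= divr_gt0// subr_gt0.
have al1 : al <= 1 / 2 by rewrite /al ge_min lexx.
have alM : al * m (~` A) <= M - eps.
  apply: (@le_trans _ _ (al * M)); first by rewrite ler_pM2l.
  by rewrite -ler_pdivlMr// /al ge_min lexx orbT.
pose W := M - al * m (~` A).
have W0 : 0 < W by rewrite /W; lra.
pose lam := eps / W.
have lam0 : 0 < lam by exact: divr_gt0.
have lam1 : lam <= 1 by rewrite ler_pdivrMr// mul1r /W; lra.
have lamW : lam * W = eps by rewrite /lam divfK// gt_eqF.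
pose l2 := lam * (1 - al).
have l2lam : l2 <= lam by rewrite /l2 ger_pMr//; lra.
have l20 : 0 < l2 by rewrite /l2 mulr_gt0//; lra.
have mfib Q : measurable (fiber Pi Q).
  have [pQ|pQ] := boolP (finset.partition Q [set: Omega]%SET); first exact: HA1T.
  rewrite (_ : fiber Pi Q = set0)//; apply/seteqP; split => // t /= tQ.
  by move: pQ; rewrite -tQ HPi.
have [m0 m00 Hm0] := @lower_bound_nonzero R _ (fun Q => m (fiber Pi Q)) (fun Q => rmeas_ge0 mu _).
pose mu0 := l2 * m0.
have mu00 : 0 < mu0 by exact: mulr_gt0.
(* Tolerance chosen to give [kappa * beta <= mu0 * (tau * rho)] below. It must be fixed before [D]
   and [c], so [m E / 2] stands in for the measure of [D] within [E], and the factor [kappa] is left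
   out. *)
pose beta := r * (m E / 2) * rho * mu0 / eps.
have mE2 : 0 < m E / 2 by rewrite divr_gt0.
have beta0 : 0 < beta.
  exact: divr_gt0 (mulr_gt0 (mulr_gt0 (mulr_gt0 r0 mE2) rho0) mu00) Heps0.
have [D [c [[mD DA] /andP[c0 c1] mDE HL HDV]]] :=
  eventual_improvement Hfin Hcomplete HA2meas HA2cont HA1q mA mEm EA mE0
    (divr_gt0 beta0 (ltr0n R 2)) if0 Kf ig1 Kg1 ib Kb ia g1V.
pose kappa := lam * al * c.
have kappa0 : 0 < kappa by exact: mulr_gt0 (mulr_gt0 lam0 al0) c0.
(* The freed amount of [e], spread evenly over a coalition of measure [eps]. *)
pose tau := kappa * r * m (D `&` E) / eps.
have mDE0 : 0 < m (D `&` E) by exact: lt_le_trans mE2 mDE.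
have tau0 : 0 < tau by exact: divr_gt0 (mulr_gt0 (mulr_gt0 kappa0 r0) mDE0) Heps0.
have mDEm : measurable (D `&` E) by exact: measurableI.
pose k t w := f t w + (al * (\1_A t : R)) *: (g1 t w - f t w) +
  (al * c * (\1_D t : R)) *: (b t w - g1 t w).
have ik w : bochner_integrable mu setT (k ^~ w).
  apply: integD => //; first apply: integD => //.
    have := integZ Hfin Hcomplete al (integ_indic Hfin Hcomplete mA (integB Hfin Hcomplete (ig1 w) (if0 w))).
    by congr bochner_integrable; apply/funext => t; rewrite scalerA.
  have := integZ Hfin Hcomplete (al * c) (integ_indic Hfin Hcomplete mD (integB Hfin Hcomplete (ib w) (ig1 w))).
  by congr bochner_integrable; apply/funext => t; rewrite scalerA.
pose h w t := k t w - a t w.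
have ih w : bochner_integrable mu setT (h w) by exact: integB.
have l1P : 0 <= lam <= 1 by rewrite ltW.
have l2P : 0 <= l2 <= 1 by rewrite ltW//=; lra.
(* The discarded agents may cost up to half of [kappa * beta]; a third for the selection error keeps
   the sum strictly below it. *)
have kb0 : 0 < kappa * beta / 3.
  by have := mulr_gt0 kappa0 beta0; lra.
have [S [mS eS fS bS]] := atomless_two_rates Hfin Hcomplete Hatomless
  mfib ih mA l1P l2P kb0.
have {}eS : m S = eps.
  by rewrite /m eS -/m -lamW /W /l2 -mAAc; ring.
(* The first two terms integrate to 0 by feasibility of [f] on [T] and of [g] on [A]; only the gain
   in [e] survives. *)
pose psi w t := l2 *: (f t w - a t w) +
  (lam * al * (1 - c)) *: ((\1_A t : R) *: (g1 t w - a t w)) -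
  (kappa * r) *: ((\1_(D `&` E) t : R) *: e).
have iAga w : bochner_integrable mu setT (fun t => (\1_A t : R) *: (g1 t w - a t w)).
  by apply: integ_indic => //; exact: integB.
have ifa w : bochner_integrable mu setT (fun t => f t w - a t w) by exact: integB.
have iDEe : bochner_integrable mu setT (fun t => (\1_(D `&` E) t : R) *: e).
  exact: integ_indic_cst.
have ipsi w : bochner_integrable mu setT (psi w).
  by apply: integB => //; [apply: integD => //|]; exact: integZ.
have psi_total w : bint mu (psi w) = - ((tau * m S) *: e).
  rewrite bintB//; [|by apply: integD => //; exact: integZ|exact: integZ].
  rewrite bintD//; try exact: integZ.
  rewrite !bintZ// fa0 ga0 !scaler0 addr0 sub0r bint_indic_cst//.
  by rewrite eS /tau divfK ?gt_eqF// scalerA.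
(* [l2] is the smaller of the two rates, so [S] holds at least this fraction of every type. *)
have S_fiber Q : l2 * m (fiber Pi Q) <= m (S `&` fiber Pi Q).
  rewrite /m fS (rmeasID Hfin mA (mfib Q)) mulrDr setDE !(setIC _ (fiber Pi Q)).
  by rewrite lerD2r ler_wpM2r// rmeas_ge0.
have S_fiber0 Q : m (S `&` fiber Pi Q) = 0 -> m (fiber Pi Q) = 0.
  move=> Q0; have := S_fiber Q; rewrite Q0 pmulr_rle0// => Q1.
  by apply/eqP; rewrite eq_le Q1 rmeas_ge0.
have mixture w t : lam *: ((\1_A t : R) *: h w t) + l2 *: ((\1_(~` A) t : R) *: h w t) =
    psi w t + kappa *: ((\1_(A `\` D) t : R) *: (g1 t w - a t w)).
  have -> : (\1_(~` A) t : R) = 1 - \1_A t.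
    rewrite !indicE; have [At|At] := pselect (A t).
      have nAt : ~ (~` A) t by move=> /(_ At).
      by rewrite (memNset nAt) (mem_set At) subrr.
    have Act : (~` A) t by exact: At.
    by rewrite (mem_set Act) (memNset At) subr0.
  have -> : (\1_(A `\` D) t : R) = \1_A t - \1_D t.
    rewrite !indicE; have [Dt|Dt] := pselect (D t).
      by rewrite (mem_set Dt) (mem_set (DA _ Dt)) memNset ?subrr// => -[].
    rewrite (memNset Dt) subr0; congr (nat_of_bool _)%:R.
    by apply/idP/idP; rewrite !inE; [case|move=> At; split].
  rewrite /h /k /psi /b indicI; apply: mixture_identity.
  rewrite !indicE; have [Dt|Dt] := pselect (D t).
    by constructor 1; rewrite (mem_set Dt) (mem_set (DA _ Dt)).
  by have [At|At] := pselect (A t); [constructor 2|constructor 3];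
    rewrite (memNset Dt) ?(memNset At) ?(mem_set At).
pose z w := imbalance mu Pi S (h w) (psi w).
have zE Q w : `|z w Q| < kappa * beta.
  pose X C := bint mu (fun t => (\1_C t : R) *: ((\1_(fiber Pi Q) t : R) *: h w t)).
  pose Z := bint mu (fun t => (\1_(fiber Pi Q) t : R) *:
    ((\1_(A `\` D) t : R) *: (g1 t w - a t w))).
  have mAD : measurable (A `\` D) by exact: measurableD.
  have iga : bochner_integrable mu setT (fun t => g1 t w - a t w) by exact: integB.
  have iAD := integ_indic Hfin Hcomplete mAD iga.
  have iX C : measurable C -> bochner_integrable mu setT
      (fun t => (\1_C t : R) *: ((\1_(fiber Pi Q) t : R) *: h w t)).
    by move=> mC; apply: integ_indic => //; exact: integ_indic.
  have e1 : lam *: X A + l2 *: X (~` A) =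
      bint mu (fun t => (\1_(fiber Pi Q) t : R) *: psi w t) + kappa *: Z.
    rewrite -!bintZ//; try exact: iX; last exact: integ_indic.
    rewrite -!bintD//; try (by apply: integZ => //; exact: iX); last 2 first.
    - exact: integ_indic.
    - by apply: integZ => //; exact: integ_indic.
    congr bint; apply/funext => t.
    have swap (p u v : R) (y : Y) : p *: (u *: (v *: y)) = v *: (p *: (u *: y)).
      by rewrite !scalerA; congr (_ *: _); ring.
    rewrite (swap lam) (swap l2) (scalerA kappa) (mulrC kappa) -(scalerA _ kappa).
    by rewrite -!scalerDr mixture.
  have -> : z w Q = (X S - lam *: X A - l2 *: X (~` A)) + kappa *: Z.
    rewrite /z /imbalance -/(X S) -[X S - _ - _]addrA -opprD e1 opprD addrA subrK//.
  have Zb : `|Z| < beta / 2.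
    rewrite -lte_fin; apply: le_lt_trans (HL w).
    apply: le_trans (le_norm_bint Hfin Hcomplete (integ_indic Hfin Hcomplete (mfib Q) iAD)) _.
    exact: (le_L1_indic Hcomplete (mfib Q) (integ_smeas Hfin iAD)).
  apply: le_lt_trans (ler_normD _ _) _.
  have h1 := bS Q w; rewrite -!/(X _) in h1.
  have : `|kappa *: Z| < kappa * (beta / 2) by rewrite normrZ gtr0_norm// ltr_pM2l.
  have := mulr_gt0 kappa0 beta0; lra.
pose tr w := transfer mu Pi S (h w) (psi w) tau e.
(* On a non-null fiber the error per agent is below [kappa * beta / mu0], hence below [tau * rho],
   the radius available around [tau *: e]. *)
have Ktr Q w : (Yp°) (tr w Q).
  rewrite /tr /transfer -scaleNr.
  apply: (interior_cone_shift Hcone_scale tau0 Hrho).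
  rewrite normrZ normrN -/(z w Q) ger0_norm ?invr_ge0 ?rmeas_ge0//.
  have [Q0|Q0] := eqVneq (m (S `&` fiber Pi Q)) 0.
    by rewrite /m in Q0; rewrite Q0 invr0 mul0r; exact: mulr_gt0.
  have mQ0 : 0 < m (S `&` fiber Pi Q) by rewrite lt_neqAle eq_sym Q0 rmeas_ge0.
  rewrite ltr_pdivrMl//; apply: lt_le_trans (zE Q w) _.
  have mQmu0 : mu0 <= m (S `&` fiber Pi Q).
    apply: le_trans (S_fiber Q); rewrite /mu0 ler_pM2l//; apply: Hm0.
    apply: contraNneq Q0 => Q0; rewrite eq_le rmeas_ge0 andbT.
    rewrite -[leRHS]Q0; apply: le_rmeas => //; exact: measurableI.
  apply: (@le_trans _ _ (mu0 * (tau * rho))); last first.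
    by rewrite ler_pM2r//; exact: mulr_gt0.
  rewrite /beta /tau.
  have -> : kappa * (r * (m E / 2) * rho * mu0 / eps) =
     (kappa * r * rho * mu0 / eps) * (m E / 2) by ring.
  have -> : mu0 * (kappa * r * m (D `&` E) / eps * rho) =
     (kappa * r * rho * mu0 / eps) * m (D `&` E) by ring.
  rewrite ler_pM2l//.
  exact: divr_gt0 (mulr_gt0 (mulr_gt0 (mulr_gt0 kappa0 r0) rho0) mu00) Heps0.
pose x t w := k t w + tr w (Pi t).
have Ktr' Q w : Yp (tr w Q) by apply: interior_subset; exact: Ktr.
have itr w := transfer_integ Hfin Hcomplete mfib mS (ih w) (ipsi w) S_fiber0 (psi_total w).
have ix w : bochner_integrable mu setT (x ^~ w).
  by apply: integD => //; have [] := itr w.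
have kD t : D t -> k t = (fun w => (1 - al) *: f t w + al *: ((1 - c) *: g1 t w + c *: b t w)).
  move=> Dt; apply/funext => w; rewrite /k !indicE (mem_set Dt) (mem_set (DA _ Dt)) !mulr1.
  move: (f t w) (g1 t w) (b t w) => u v y.
  rewrite !scalerBr !scalerBl !scale1r scalerDr scalerBr !scalerA.
  by rewrite (addrC (al *: v) (- _)) (addrC ((al * c) *: y) (- _)) !addrA.
have kA t : A t -> ~ D t -> k t = (fun w => (1 - al) *: f t w + al *: g1 t w).
  move=> At Dt; apply/funext => w; rewrite /k !indicE (memNset Dt) (mem_set At).
  by rewrite mulr1 mulr0 scale0r addr0 scalerBl scale1r scalerBr addrAC addrA.
have kN t : ~ A t -> k t = f t.
  move=> At; have Dt : ~ D t by move/DA.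
  by apply/funext => w; rewrite /k !indicE (memNset Dt) (memNset At) !mulr0 !scale0r !addr0.
have conv (l : R) u v : 0 <= l <= 1 -> Yp u -> Yp v -> Yp ((1 - l) *: u + l *: v).
  by move=> /andP[l0 l1] Ku Kv; apply: Hcone_add; apply: Hcone_scale => //; lra.
have al01 : 0 <= al <= 1 by rewrite ltW//=; lra.
have c01 : 0 <= c <= 1 by rewrite ltW.
have Kk t w : Yp (k t w).
  have [At|At] := pselect (A t); last by rewrite kN.
  have [Dt|Dt] := pselect (D t); last by rewrite kA//; apply: (conv al).
  by rewrite kD//; apply: (conv al) => //; apply: (conv c).
have Vconc t (u v : Omega -> Y) (l : R) : 0 <= l <= 1 -> (forall w, Yp (u w)) ->
    (forall w, Yp (v w)) ->
    (1 - l) * V t u + l * V t v <= V t (fun w => (1 - l) *: u w + l *: v w).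
  move=> l01 Ku Kv; rewrite /V !mulr_sumr -big_split/=; apply: ler_sum => w _.
  rewrite !mulrA -mulrDl ler_pM2r//.
  have l01' : 0 <= 1 - l <= 1 by move: l01 => /andP[? ?]; apply/andP; split; lra.
  have := HA4 t w _ _ (1 - l) (Ku w) (Kv w) l01'.
  by rewrite (_ : 1 - (1 - l) = l)//; lra.
(* A weak inequality is enough, and is all that holds off [A], where [k] is [f]; strictness comes
   from the transfers. *)
have Vk : {ae mu, forall t, V t (f t) <= V t (k t)}.
  apply: filterS g1V => t g1t.
  have [At|At] := pselect (A t); last by rewrite kN.
  have step (y : Omega -> Y) : (forall w, Yp (y w)) -> V t (f t) < V t y ->
      V t (f t) <= V t (fun w => (1 - al) *: f t w + al *: y w).
    move=> Ky fy; apply: le_trans (Vconc t (f t) y al al01 (Kf t) Ky).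
    have : al * V t (f t) <= al * V t y by rewrite ler_pM2l// ltW.
    lra.
  have [Dt|Dt] := pselect (D t); last by rewrite kA//; apply: step => //; exact: g1t.
  rewrite kD//; apply: (step (fun w => (1 - c) *: g1 t w + c *: b t w)).
    by move=> w; exact: conv.
  apply: lt_le_trans (HDV t Dt) _; exact: Vconc.
(* [Omega] is nonempty because the priors sum to 1, so at least one state yields a strict gain. *)
have Vx t : V t (k t) < V t (x t).
  have [w0 _] : exists w : Omega, True.
    apply: contrapT => nO; have := Hq_sum t; rewrite big1; last first.
      by move=> w; exfalso; apply: nO; exists w.
    by move/eqP; rewrite eq_sym oner_eq0.
  rewrite /V (bigD1 w0)//= [in ltRHS](bigD1 w0)//=; apply: ltr_leD.
    by rewrite ltr_pM2r//; apply: HA3.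
  by apply: ler_sum => w _; rewrite ler_pM2r//; apply/ltW/HA3.
have bk : {ae mu, forall t, block_constant (Pi t) (k t)}.
  apply: filterS2 bf bg1 => t bft bgt B w w' BP wB w'B.
  by rewrite /k /b (bft B w w')// (bgt B w w')// (Ha_const t B w w').
(* The fiber indicator keeps only agents of type [Q], for whom every integrand takes the same value
   at two states of a block, almost everywhere. *)
have bz Q : block_constant Q (fun w => z w Q).
  move=> B w w' BP wB w'B; rewrite /z /imbalance; congr (_ - _).
    apply: ae_eq_bint => //; try (by apply: integ_indic => //; exact: integ_indic).
    apply: filterS bk => t bkt; have [tQ|tQ] := pselect (fiber Pi Q t); last first.
      by rewrite (indicE _ (fiber Pi Q)) memNset// !scale0r.
    by move: BP; rewrite -tQ => BP; rewrite /h (bkt B w w')// (Ha_const t B w w').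
  apply: ae_eq_bint => //; try exact: integ_indic.
  apply: filterS2 bf bg1 => t bft bgt; have [tQ|tQ] := pselect (fiber Pi Q t); last first.
    by rewrite (indicE _ (fiber Pi Q)) memNset// !scale0r.
  move: BP; rewrite -tQ => BP.
  by rewrite /psi (bft B w w')// (bgt B w w')// (Ha_const t B w w').
exists S; split; last by rewrite mE// eS.
split=> //; first by rewrite mE// eS lte_fin.
exists x; split.
- split.
  + by move=> t w _; apply: Hcone_add.
  + move=> w; have [v Bv] := integ_indic Hfin Hcomplete mS (ix w).
    by exists v; exact: bochner_of_setT.
  + apply: filterS bk => t bkt _; apply/P_measurable_block_constant => B w w' BP wB w'B.
    rewrite /x (bkt B w w')// /tr /transfer.
    by have := bz (Pi t) B w w' BP wB w'B; rewrite /z => ->.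
- move=> w; exists (bint mu (fun t => (\1_S t : R) *: a t w)); split; last first.
    by apply: bochner_of_setT => //; apply: bintP => //; exact: integ_indic.
  apply: bochner_of_setT => //.
  suff <- : bint mu (fun t => (\1_S t : R) *: x t w) =
      bint mu (fun t => (\1_S t : R) *: a t w).
    by apply: bintP => //; exact: integ_indic.
  have [itr1 itr2] := itr w.
  apply/eqP; rewrite -subr_eq0 -bintB//; try exact: integ_indic.
  have -> : (fun t => (\1_S t : R) *: x t w - (\1_S t : R) *: a t w) =
      (fun t => (\1_S t : R) *: h w t + (\1_S t : R) *: tr w (Pi t)).
    by apply/funext => t; rewrite -scalerBr -scalerDr /x /h addrAC.
  rewrite bintD//; try exact: integ_indic.
  by rewrite itr2 subrr.
- apply: filterS Vk => t Vkt _; exact: le_lt_trans Vkt (Vx t).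
Qed.
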